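(* Let $r\in(0,\infty)$ and $D=9r^2+26r+15$. The sequence $\{\beta_j(r)\}_{j\ge0}$, together with the values $a_{j,2},\dots,f_{j,2}$ of $P^{(r)}_{j,2}$ on $V_1$, satisfies for every $j\ge0$ the system $$\begin{aligned} \lambda_{\mathrm{sym}}(r)L(r)^j\beta_j(r)+r a_{j,2}+r b_{j,2}&=(2+2r)\sum_{i=0}^j\lambda_{\mathrm{sym}}(r)L(r)^j\alpha_i(r)\beta_{j-i}(r),\\ \lambda_{\mathrm{sym}}(r)L(r)^j\beta_j(r)+b_{j,2}+c_{j,2}+d_{j,2}&=4\sum_{i=0}^jL(r)^i\alpha_i(r)a_{j-i,2},\\ 2\lambda_{\mathrm{sym}}(r)L(r)^j\beta_j(r)+2a_{j,2}&=4\sum_{i=0}^jL(r)^i\alpha_i(r)b_{j-i,2},\\ \beta_j(r)+r a_{j,2}+r d_{j,2}+e_{j,2}&=(2+2r)\sum_{i=0}^jL(r)^i\alpha_i(r)c_{j-i,2},\\ a_{j,2}+c_{j,2}+e_{j,2}+f_{j,2}&=4\sum_{i=0}^jL(r)^i\alpha_i(r)d_{j-i,2},\\ \beta_j(r)+c_{j,2}+r d_{j,2}+r f_{j,2}&=(2+2r)\sum_{i=0}^jL(r)^i\alpha_i(r)e_{j-i,2},\\ 2d_{j,2}+2e_{j,2}&=4\sum_{i=0}^jL(r)^i\alpha_i(r)f_{j-i,2}, \end{aligned}$$ with initial data $$\beta_0(r)=-\tfrac12,\quad a_{0,2}=-\frac{3r^2+8r+4}{D},\quad b_{0,2}=-\frac{3r^2+7r+2}{D},\quad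 c_{0,2}=-\frac{6r^2+19r+15}{2D},$$ $$d_{0,2}=-\frac{6r^2+19r+13}{2D},\quad e_{0,2}=-\frac{6r^2+21r+15}{2D},\quad f_{0,2}=-\frac{3r^2+10r+7}{D}.$$ The sequence $\{\gamma_j(r)\}_{j\ge0}$, together with the values $a_{j,3},c_{j,3},d_{j,3},e_{j,3}$ of $P^{(r)}_{j,3}$ on $V_1$, satisfies for every $j\ge0$ the system $$\begin{aligned} -\lambda_{\mathrm{skew}}(r)L(r)^j\gamma_j(r)+r a_{j,3}&=(2+2r)\sum_{i=0}^j\lambda_{\mathrm{skew}}(r)L(r)^j\alpha_i(r)\gamma_{j-i}(r),\\ \lambda_{\mathrm{skew}}(r)L(r)^j\gamma_j(r)+c_{j,3}+d_{j,3}&=4\sum_{i=0}^jL(r)^i\alpha_i(r)a_{j-i,3},\\ \gamma_j(r)+r a_{j,3}+r d_{j,3}+e_{j,3}&=(2+2r)\sum_{i=0}^jL(r)^i\alpha_i(r)c_{j-i,3},\\ a_{j,3}+c_{j,3}+e_{j,3}&=4\sum_{i=0}^jL(r)^i\alpha_i(r)d_{j-i,3},\\ \gamma_j(r)+c_{j,3}+r d_{j,3}&=(2+2r)\sum_{i=0}^jL(r)^i\alpha_i(r)e_{j-i,3}, \end{aligned}$$ with initial data $$\gamma_0(r)=\tfrac12,\quad a_{0,3}=\frac{2r+3}{D},\quad c_{0,3}=\frac{9r+15}{2D},\quad d_{0,3}=\frac{5r+9}{2D},\quad e_{0,3}=\frac{7r+15}{2D}.$$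
   Context: Let $q_0,q_1,q_2$ be the vertices of a triangle in the plane, $F_i(x)=\tfrac12(x-q_i)+q_i$, and $F_{ij}=F_i\circ F_j$ for $i,j\in\{0,1,2\}$; indices of the $q_i$ are cyclic mod 3. The Sierpinski gasket $SG$ is the unique nonempty compact set with $SG=\bigcup_{i,j}F_{ij}SG$. Put $V_0=\{q_0,q_1,q_2\}$ (the boundary), $V_{m+1}=\bigcup_{i,j}F_{ij}V_m$. The graph $\Gamma_m$ has vertex set $V_m$ and an edge $x\sim_m y$ when $x=F_wq_j$, $y=F_wq_k$, $j\ne k$, for some $F_w$ a composition of $m$ of the maps $F_{ij}$. Fix $r\in(0,\infty)$ and set $D(r)=9r^2+26r+15$, $r_0(r)=\frac{6r(r+2)}{D(r)}$, $r_1(r)=\frac{6(r+2)}{D(r)}$, $\mu_0(r)=\frac1{3(2r+1)}$, $\mu_1(r)=\frac r{3(2r+1)}$, $L(r)=\frac{2r(r+2)}{(2r+1)D(r)}$, $\lambda_{\mathrm{sym}}(r)=r_0(r)$, $\lambda_{\mathrm{skew}}(r)=\frac{2r}{D(r)}$. Resistances: $\mathrm{res}_0(x,y)=1$ on edges of $\Gamma_0$, and $\mathrm{res}_{m+1}(F_{ij}x,F_{ij}y)=r_0(r)\,\mathrm{res}_m(x,y)$ if $i=j$, $=r_1(r)\,\mathrm{res}_m(x,y)$ if $i\neq j$. Energy: $\mathcal{E}_r(u,v)=\lim_{m\to\infty}\sum_{x\sim_m y}\mathrm{res}_m(x,y)^{-1}(u(x)-u(y))(v(x)-v(y))$ (each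 edge counted once); $\operatorname{dom}\mathcal{E}_r$ is the set of (continuous) functions $u$ on $SG$ with $\mathcal{E}_r(u,u)<\infty$. Measure: $\mu_r$ is the self-similar Borel probability measure on $SG$ with $\mu_r(F_{ij}A)=\mu_0(r)\mu_r(A)$ if $i=j$ and $=\mu_1(r)\mu_r(A)$ if $i\ne j$. Laplacian: $u\in\operatorname{dom}\Delta_r$ with $\Delta_ru=f$ means that $u\in\operatorname{dom}\mathcal{E}_r$, $f$ is continuous on $SG$, and $-\mathcal{E}_r(u,v)=\int_{SG}vf\,d\mu_r$ for all $v\in\operatorname{dom}\mathcal{E}_r$ vanishing on $V_0$. Boundary derivatives: $\partial_{n,r}u(q_i)=\lim_{m\to\infty}\lambda_{\mathrm{sym}}(r)^{-m}(2u(q_i)-u(F_{ii}^mq_{i+1})-u(F_{ii}^mq_{i-1}))$, $\ \partial_{T,r}u(q_i)=\lim_{m\to\infty}\lambda_{\mathrm{skew}}(r)^{-m}(u(F_{ii}^mq_{i+1})-u(F_{ii}^mq_{i-1}))$. A polynomial is a function $P$ on $SG$ with $\Delta_r^{n+1}P=0$ for some $n\ge0$. The space of such $P$ for fixed $n$ has dimension $3n+3$ and $P$ is uniquely determined by the values $\Delta_r^lP(q_0),\partial_{n,r}\Delta_r^lP(q_0),\partial_{T,r}\Delta_r^lP(q_0)$, $0\le l\le n$. The monomials $P^{(r)}_{j,k}$ ($j\ge0$, $k=1,2,3$) are the polynomials determined by $\Delta_r^lP^{(r)}_{j,k}(q_0)=\delta_{jl}\delta_{k1}$, $\partial_{n,r}\Delta_r^lP^{(r)}_{j,k}(q_0)=\delta_{jl}\delta_{k2}$,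 $\partial_{T,r}\Delta_r^lP^{(r)}_{j,k}(q_0)=\delta_{jl}\delta_{k3}$ for all $l\ge0$. Put $\alpha_j(r)=P^{(r)}_{j,1}(q_1)$, $\beta_j(r)=P^{(r)}_{j,2}(q_1)$, $\gamma_j(r)=P^{(r)}_{j,3}(q_1)$. Values on $V_1$ (dependence on $r$ suppressed), for $k=2,3$: $a_{j,k}=P^{(r)}_{j,k}(F_{01}q_1)$, $b_{j,2}=P^{(r)}_{j,2}(F_{01}q_2)$, $c_{j,k}=P^{(r)}_{j,k}(F_{11}q_0)$, $d_{j,k}=P^{(r)}_{j,k}(F_{10}q_2)$, $e_{j,k}=P^{(r)}_{j,k}(F_{11}q_2)$, $f_{j,2}=P^{(r)}_{j,2}(F_{12}q_2)$. (At the mirror-image points under the reflection exchanging $q_1,q_2$, the values of $P_{j,2}^{(r)}$ are the same and those of $P_{j,3}^{(r)}$ are negated.) *)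

(* Defs.v *)
From HB Require Import structures.
From mathcomp Require Import all_boot all_order all_algebra.
From mathcomp Require Import all_classical all_reals all_analysis.

Set Implicit Arguments.
Unset Strict Implicit.
Unset Printing Implicit Defensive.

Import Order.TTheory GRing.Theory Num.Theory.
Import numFieldNormedType.Exports.

Local Open Scope classical_set_scope.
Local Open Scope ring_scope.

Section Constants.
Variables (R : realType) (r : R).

Definition Dpar : R := 9 * r ^+ 2 + 26 * r + 15.
Definition res0 : R := 6 * r * (r + 2) / Dpar.
Definition res1 : R := 6 * (r + 2) / Dpar.
Definition mu0 : R := 1 / (3 * (2 * r + 1)).
Definition mu1 : R := r / (3 * (2 * r + 1)).
Definition Lpar : R := 2 * r * (r + 2) / ((2 * r + 1) * Dpar).
Definition lambda_sym : R := res0.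
Definition lambda_skew : R := 2 * r / Dpar.

Definition res_factor (i j : 'I_3) : R := if i == j then res0 else res1.
Definition mu_factor (i j : 'I_3) : R := if i == j then mu0 else mu1.

(** Resistance of the edges of the cell [F_w SG], see [Fword] below. *)
Fixpoint res_word (w : seq ('I_3 * 'I_3)) : R :=
  if w is p :: w' then res_factor p.1 p.2 * res_word w' else 1.

End Constants.

Notation plane R := 'rV[R]_2.

Section Gasket.
Variables (R : realType) (q : 'I_3 -> plane R).

(** Arithmetic on ['I_3] is modulo 3, so [q (i + 1)] and [q (i - 1)] are the
    cyclic neighbours of [q i]. *)
Definition is_triangle : Prop := row_free (col_mx (q 1 - q 0) (q 2 - q 0)).

Definition F1 (i : 'I_3) (x : plane R) : plane R := 2^-1 *: (x - q i) + q i.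

Definition F (i j : 'I_3) (x : plane R) : plane R := F1 i (F1 j x).

Fixpoint Fword (w : seq ('I_3 * 'I_3)) (x : plane R) : plane R :=
  if w is p :: w' then F p.1 p.2 (Fword w' x) else x.

(** By Hutchinson's theorem exactly one set satisfies this. *)
Definition is_gasket (SG : set (plane R)) : Prop :=
  [/\ compact SG, SG !=set0 &
      SG = \bigcup_(p in [set: 'I_3 * 'I_3]) (F p.1 p.2 @` SG)].

End Gasket.

(** Functions on [SG] are represented by functions on the plane; only their
    values on [SG] matter. *)

Section Analysis.
Variables (R : realType) (q : 'I_3 -> plane R) (SG : set (plane R)) (r : R).

(** The edges of the level [m] graph are the pairs [F_w q_j], [F_w q_k] with
    [w] a word of length [m] and [j <> k].  Two distinct cells of level [m]
    share at most one vertex, so summing over [w] and [j < k] counts each edge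
    exactly once, and the resistance of an edge depends only on its word. *)
Definition graph_energy (m : nat) (u v : plane R -> R) : R :=
  \sum_(w : m.-tuple ('I_3 * 'I_3)) \sum_(j < 3) \sum_(k < 3 | (j < k)%N)
    (res_word r w)^-1 *
    ((u (Fword q w (q j)) - u (Fword q w (q k))) *
     (v (Fword q w (q j)) - v (Fword q w (q k)))).

Definition energy (u v : plane R -> R) : R :=
  limn (fun m => graph_energy m u v).

(** The graph energies [graph_energy m u u] are nonnegative and nondecreasing
    in [m], so converging in [R] means having a finite limit. *)
Definition dom_energy (u : plane R -> R) : Prop :=
  {within SG, continuous u} /\ cvgn (fun m => graph_energy m u u).

Definition borel_plane := g_sigma_algebraType (@open (plane R)).

Definition is_selfsimilar_measure (mu : probability borel_plane R) : Prop :=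
  mu SG = 1%E /\
  forall (i j : 'I_3) (A : set borel_plane), measurable A -> A `<=` SG ->
    mu (F q i j @` A) = ((mu_factor r i j)%:E * mu A)%E.

Definition has_laplacian (mu : probability borel_plane R)
    (u f : plane R -> R) : Prop :=
  [/\ dom_energy u, {within SG, continuous f} &
      forall v : plane R -> R, dom_energy v -> (forall i, v (q i) = 0) ->
        (- energy u v)%:E = (\int[mu]_(x in SG) (v x * f x)%:E)%E].

Definition has_normal_deriv (u : plane R -> R) (i : 'I_3) (c : R) : Prop :=
  (fun m : nat => lambda_sym r ^- m *
     (2 * u (q i) - u (iter m (F q i i) (q (i + 1)))
                  - u (iter m (F q i i) (q (i - 1))))) @ \oo --> c.

Definition has_tangential_deriv (u : plane R -> R) (i : 'I_3) (c : R) : Prop :=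
  (fun m : nat => lambda_skew r ^- m *
     (u (iter m (F q i i) (q (i + 1))) - u (iter m (F q i i) (q (i - 1)))))
    @ \oo --> c.

Definition iterated_laplacians (mu : probability borel_plane R)
    (P : plane R -> R) (Dl : nat -> plane R -> R) : Prop :=
  Dl 0%N = P /\ forall l, has_laplacian mu (Dl l) (Dl l.+1).

(** [P] is the monomial P_(j,k), with [k] ranging over 1, 2, 3; [Dl l] is the
    [l]-th iterated Laplacian of [P]. *)
Definition is_monomial (mu : probability borel_plane R) (j k : nat)
    (P : plane R -> R) : Prop :=
  exists Dl : nat -> plane R -> R,
    [/\ iterated_laplacians mu P Dl,
        exists n : nat, forall x, SG x -> Dl n.+1 x = 0 &
        forall l : nat,
          [/\ Dl l (q 0) = ((j == l) && (k == 1%N))%:R,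
              has_normal_deriv (Dl l) 0 ((j == l) && (k == 2%N))%:R &
              has_tangential_deriv (Dl l) 0 ((j == l) && (k == 3%N))%:R]].

End Analysis.

(* Main.v *)
(** The function [u o F_w] on a cell is again a polynomial, with Laplacians
    [L^|w| (Delta^l u) o F_w], because resistance times measure equals [L] for
    every cell.  A polynomial with [Delta^(n+1) u = 0] is determined by the data of
    its iterated Laplacians at a corner [q_i], hence is a combination of rotated
    monomials; by reflection symmetry the sum of its values at the two other corners
    is [2 sum_l (alpha_l Delta^l u (q_i) + beta_l d_n Delta^l u (q_i))].  Apply this
    in the two cells that meet at a junction point and add, weighting by inverse
    resistances: the normal derivatives cancel, and since
    [Delta^l P_(j,k) = P_(j-l,k)] each equation of the system appears, one per
    junction point.

    All of this only involves the values at the vertices.  The weak definition of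
    the Laplacian is tested against piecewise harmonic splines, whose energy with any
    function is a finite sum, and the integral over the gasket is the limit of
    self-similar Riemann sums.  The result is that the normal derivatives in the two
    cells at a junction point add up to zero. *)

Require Import Defs.
From HB Require Import structures.
From mathcomp Require Import all_boot all_order all_algebra.
From mathcomp Require Import all_classical all_reals all_analysis.
From mathcomp Require Import measurable_realfun perm ring lra.
Import Order.TTheory GRing.Theory Num.Theory.
Import numFieldNormedType.Exports.
Local Open Scope classical_set_scope.
Local Open Scope ring_scope.
Set Implicit Arguments.
Unset Strict Implicit.

(** * Cells, junction points and harmonic extension *)

(** The value of [res0] is the one for which harmonic extension to the next level keeps the current
    at each corner ([lap_hstep_corner]); with Kirchhoff's law at the junctions this makes graph
    energies against harmonic functions independent of the level. Two obstacles shape the proof. The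
    tangential derivative is a limit that is not known to exist for a pulled-back polynomial at an
    arbitrary corner, so the expansion at a corner leaves the coefficients of the [P_(l,3)]
    unspecified; they disappear because these monomials are odd under the reflection and only the
    sum of two values is used. Further, a monomial is only known to have one iterated Laplacian that
    vanishes, while the chain of Laplacians goes on; that the later ones vanish as well requires
    that 0 is the only Laplacian of the zero function, which holds because every cell has positive
    mass. *)

Local Notation cell := ('I_3 * 'I_3)%type.

Definition o0 : 'I_3 := @Ordinal 3 0 isT.
Definition o1 : 'I_3 := @Ordinal 3 1 isT.
Definition o2 : 'I_3 := @Ordinal 3 2 isT.

Lemma ord3_ind (Q : 'I_3 -> Prop) : Q o0 -> Q o1 -> Q o2 -> forall i, Q i.
Proof.
move=> Q0 Q1 Q2 [[|[|[|m]]] lti] //.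
- by rewrite (_ : Ordinal lti = o0) //; apply: val_inj.
- by rewrite (_ : Ordinal lti = o1) //; apply: val_inj.
- by rewrite (_ : Ordinal lti = o2) //; apply: val_inj.
Qed.

Lemma sum3 (V : nmodType) (G : 'I_3 -> V) : \sum_i G i = G o0 + G o1 + G o2.
Proof.
rewrite !big_ord_recl big_ord0 addr0 addrA.
by congr (G _ + G _ + G _); apply: val_inj.
Qed.

(* The pair [((a, b), i)] stands for the vertex [F_a F_b q_i], whose barycentric
   coordinates are a quarter of [2 e_a + e_b + e_i].  Each vertex of [V_1] except
   [q_0], [q_1], [q_2] is given by exactly two such pairs, exchanged by [mate]. *)
Definition mate (x : cell * 'I_3) : cell * 'I_3 :=
  if x.1.2 == x.2 then ((x.2, x.1.1), x.1.1) else ((x.1.1, x.2), x.1.2).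

Definition corner (x : cell * 'I_3) : bool := (x.1.1 == x.2) && (x.1.2 == x.2).

Lemma mateK : involutive mate.
Proof.
move=> [[a b] i]; rewrite /mate /=; case: (eqVneq b i) => [->|bi] /=.
  by rewrite eqxx.
by rewrite [i == b]eq_sym (negbTE bi).
Qed.

Lemma corner_mate x : corner (mate x) = corner x.
Proof.
case: x => [[a b] i]; rewrite /mate /corner /=; case: (eqVneq b i) => [_|bi] /=.
  by rewrite eqxx !andbT eq_sym.
by rewrite [i == b]eq_sym (negbTE bi) !andbF.
Qed.

Section Weights.
Variables (R : realType) (r : R).
Hypothesis r_gt0 : 0 < r.

Ltac pos_neq0 := move: r_gt0 => rpos; repeat (apply/andP; split); apply: lt0r_neq0;
  rewrite ?addr_gt0 ?mulr_gt0 //; try nra.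
Lemma Dpar_gt0 : 0 < Dpar r.
Proof. by have := sqr_ge0 r; have := r_gt0; rewrite /Dpar; lra. Qed.

Definition resf (p : cell) : R := res_factor r p.1 p.2.
Definition muf (p : cell) : R := mu_factor r p.1 p.2.

Lemma res0_gt0 : 0 < res0 r.
Proof. by rewrite divr_gt0 ?Dpar_gt0 // !mulr_gt0 // ?addr_gt0. Qed.

Lemma res1_gt0 : 0 < res1 r.
Proof. by rewrite divr_gt0 ?Dpar_gt0 // !mulr_gt0 // ?addr_gt0. Qed.

Lemma resf_gt0 p : 0 < resf p.
Proof. by rewrite /resf /res_factor; case: ifP => _; rewrite ?res0_gt0 ?res1_gt0. Qed.

Lemma muf_gt0 p : 0 < muf p.
Proof.
by rewrite /muf /mu_factor /mu0 /mu1; case: ifP => _; rewrite divr_gt0 // mulr_gt0 // addr_gt0 // mulr_gt0.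
Qed.

Lemma sum_cell (V : nmodType) (G : cell -> V) :
  \sum_p G p = \sum_i \sum_j G (i, j).
Proof. by rewrite pair_big /=; apply: eq_bigr => -[]. Qed.

Lemma sum_muf : \sum_p muf p = 1.
Proof.
rewrite sum_cell !sum3 /muf /mu_factor /= /mu0 /mu1.
field; pos_neq0.
Qed.

Lemma resf_muf p : resf p * muf p = Lpar r.
Proof.
have := Dpar_gt0; rewrite /resf /muf /res_factor /mu_factor /res0 /res1 /mu0 /mu1 /Lpar.
by case: ifP => _ D0; field; pos_neq0.
Qed.

Lemma Lpar_gt0 : 0 < Lpar r.
Proof. by rewrite -(resf_muf (o0, o0)) mulr_gt0 ?resf_gt0 ?muf_gt0. Qed.

(* [hnum p i k / D] is the value at [F_p q_i] of the harmonic function that is 1 at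
   [q_k] and 0 at the two other corners; it depends only on the barycentric
   coordinates of the vertex.  The entries solve the Kirchhoff equations at the 12
   vertices of [V_1] outside [V_0], see [lap_hstep]. *)
Definition hnum (p : cell) (i k : 'I_3) : R :=
  let: (a, b) := p in
  match (2 * (a == k) + (b == k) + (i == k))%N with
  | 0 => if b == i then if a == b then 0 else 3 * r ^+ 2 + 6 * r + 1
         else 3 * r ^+ 2 + 5 * r
  | 1 => if (a == b) || (a == i) then 3 * r ^+ 2 + 7 * r
         else 3 * r ^+ 2 + 7 * r + 2
  | 2 => if b == i then 3 * r ^+ 2 + 10 * r + 7 else 3 * r ^+ 2 + 12 * r + 11
  | 3 => 3 * r ^+ 2 + 14 * r + 15
  | _ => Dpar r
  end.

Definition hstep (p : cell) (c : 'I_3 -> R) (i : 'I_3) : R :=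
  \sum_k hnum p i k / Dpar r * c k.

Lemma hstepE p c i : hstep p c i = \sum_k hnum p i k / Dpar r * c k.
Proof. by []. Qed.

(** Twice the value at [i] minus the two other values. The full sum makes a permutation of the
    corners a plain reindexing. *)
Definition lap (c : 'I_3 -> R) (i : 'I_3) : R := 3 * c i - \sum_k c k.

Lemma sum_hnum p i : \sum_k hnum p i k = Dpar r.
Proof.
case: p => a b; rewrite sum3.
elim/ord3_ind: a; elim/ord3_ind: b; elim/ord3_ind: i; rewrite /hnum /= /Dpar; ring.
Qed.

Lemma hnum_ge0 p i k : 0 <= hnum p i k.
Proof.
have := Dpar_gt0; case: p => a b D0; have r2 := sqr_ge0 r; have r1 := r_gt0.
by elim/ord3_ind: a; elim/ord3_ind: b; elim/ord3_ind: i; elim/ord3_ind: k; rewrite /hnum /= ?lexx //; try exact: ltW; lra.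
Qed.

Lemma hnum_mate x k : hnum (mate x).1 (mate x).2 k = hnum x.1 x.2 k.
Proof.
case: x => [[a b] i].
by elim/ord3_ind: a; elim/ord3_ind: b; elim/ord3_ind: i; elim/ord3_ind: k; rewrite /hnum /mate /=.
Qed.

Lemma hstep_mate x c : hstep (mate x).1 c (mate x).2 = hstep x.1 c x.2.
Proof. by apply: eq_bigr => k _; rewrite hnum_mate. Qed.

Lemma hstep_corner i c : hstep (i, i) c i = c i.
Proof.
have /lt0r_neq0 D0 := Dpar_gt0.
by elim/ord3_ind: i; rewrite /hstep sum3 /= divff //; ring.
Qed.

Lemma lap_hstep x c : ~~ corner x ->
  (resf x.1)^-1 * lap (hstep x.1 c) x.2
  + (resf (mate x).1)^-1 * lap (hstep (mate x).1 c) (mate x).2 = 0.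
Proof.
have D0 := Dpar_gt0.
case: x => [[a b] i].
elim/ord3_ind: a; elim/ord3_ind: b; elim/ord3_ind: i => //= _;
 rewrite /lap /hstep /resf /res_factor /= !sum3 /= /res0 /res1; 
 rewrite /Dpar in D0 *; field; pos_neq0.
Qed.

(** This determines [res0]: the current at a corner of the triangle is unchanged by refinement. *)
Lemma lap_hstep_corner i c : (resf (i, i))^-1 * lap (hstep (i, i) c) i = lap c i.
Proof.
have D0 := Dpar_gt0.
elim/ord3_ind: i; rewrite /lap /hstep /resf /res_factor /= !sum3 /= /res0; 
 rewrite /Dpar in D0 *; field; pos_neq0.
Qed.
End Weights.

Lemma sum_pair (V : nmodType) (G : cell * 'I_3 -> V) :
  \sum_x G x = \sum_p \sum_i G (p, i).
Proof. by rewrite pair_big /=; apply: eq_bigr => -[]. Qed.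

(** The sum over the non-corners is equal to its own reindexing by [mate], so its double is a sum of
    zeros. Every cancellation at junction points goes through this. *)
Lemma sum_mate (R : realType) (G : cell * 'I_3 -> R) :
  (forall x, ~~ corner x -> G x + G (mate x) = 0) ->
  \sum_x G x = \sum_i G ((i, i), i).
Proof.
move=> G0; rewrite (bigID corner) /=.
have -> : \sum_(x | ~~ corner x) G x = 0.
  have S0 : \sum_(x | ~~ corner x) G x + \sum_(x | ~~ corner x) G x = 0.
    rewrite {2}(reindex_inj (inv_inj mateK)) /=.
    rewrite [X in _ + X](eq_bigl (fun x => ~~ corner x)); last first.
      by move=> x; rewrite corner_mate.
    by rewrite -big_split /= big1.
  by lra.
rewrite addr0 big_mkcond /= sum_pair.
by rewrite sum_cell !sum3 /corner /= !add0r !addr0.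
Qed.

Lemma lim_uniq (R : realType) (u : nat -> R) (a b : R) :
  u @ \oo --> a -> u @ \oo --> b -> a = b.
Proof. by move=> ua ub; apply: (cvg_unique _ ua ub). Qed.

Lemma cvgn_sum (R : realType) (I : finType) (u : I -> nat -> R) (l : I -> R) :
  (forall i, u i @ \oo --> l i) ->
  (fun m => \sum_i u i m) @ \oo --> \sum_i l i.
Proof.
move=> ul; elim: (index_enum I) => [|i s IH].
  rewrite big_nil (_ : (fun m => _) = fun=> 0); first exact: cvg_cst.
  by apply/funext => m; rewrite big_nil.
rewrite big_cons (_ : (fun m => _) = (fun m => u i m + \sum_(j <- s) u j m)).
  by apply: cvgD.
by apply/funext => m; rewrite big_cons.
Qed.

(** * Functions sampled at the vertices *)

(* [u w i] is the value at [F_w q_i]. *)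
Definition sample (R : realType) := seq cell -> 'I_3 -> R.

Section Samples.
Variables (R : realType).
Implicit Types (u v f g : sample R) (p : cell) (w : seq cell) (a : R).

Definition pull p u : sample R := fun w => u (p :: w).
Definition pullw w u : sample R := fun w' => u (w ++ w').
Definition linS a u v : sample R := fun w k => u w k + a * v w k.
Definition scaleS a u : sample R := fun w k => a * u w k.
Definition mulS u v : sample R := fun w k => u w k * v w k.
Definition zeroS : sample R := fun _ _ => 0.
Definition delta (k : 'I_3) : 'I_3 -> R := fun i => (i == k)%:R.

Lemma sampleP u v : (forall w i, u w i = v w i) -> u = v.
Proof. by move=> uv; apply/funext => w; apply/funext => i. Qed.

Lemma scaleS_linS a u : scaleS a u = linS a zeroS u.
Proof. by apply: sampleP => w i; rewrite /linS /scaleS add0r. Qed.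

Lemma scl0 a : scaleS a zeroS = zeroS.
Proof. by apply: sampleP => w i; rewrite /scaleS mulr0. Qed.

Lemma scl1 u : scaleS 1 u = u.
Proof. by apply: sampleP => w i; rewrite /scaleS mul1r. Qed.

Lemma sclA a b u : scaleS a (scaleS b u) = scaleS (a * b) u.
Proof. by apply: sampleP => w i; rewrite /scaleS mulrA. Qed.

Lemma lin00 a : linS a zeroS zeroS = zeroS.
Proof. by apply: sampleP => w i; rewrite /linS mulr0 addr0. Qed.

Lemma sum_delta (c : 'I_3 -> R) k : \sum_i c i * delta k i = c k.
Proof.
rewrite (bigD1 k) //= /delta eqxx mulr1 big1 ?addr0 // => i /negbTE ->.
by rewrite mulr0.
Qed.

(** The two kinds of coincidence among addresses: junction points shared by two cells of the same
    parent, and a corner that is again a corner of a smaller cell. *)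
Definition compat u : Prop :=
  (forall w x, u (rcons w (mate x).1) (mate x).2 = u (rcons w x.1) x.2) /\
  (forall w i, u (rcons w (i, i)) i = u w i).

Lemma compat_pull p u : compat u -> compat (pull p u).
Proof.
by move=> [u1 u2]; split=> [w x|w i]; rewrite /pull -!rcons_cons ?u1 ?u2.
Qed.

Lemma compat_linS a u v : compat u -> compat v -> compat (linS a u v).
Proof.
by move=> [u1 u2] [v1 v2]; split=> [w x|w i]; rewrite /linS ?u1 ?v1 ?u2 ?v2.
Qed.

Lemma lap_sym (c d : 'I_3 -> R) :
  \sum_i c i * lap d i = \sum_i d i * lap c i.
Proof. by rewrite /lap !sum3; ring. Qed.

Lemma lap_sqr (d : 'I_3 -> R) : \sum_i d i * lap d i =
  (d o0 - d o1) ^+ 2 + (d o0 - d o2) ^+ 2 + (d o1 - d o2) ^+ 2.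
Proof. by rewrite /lap !sum3; ring. Qed.

Variable (r : R).
Hypothesis r_gt0 : 0 < r.
Local Notation hstep := (hstep r).
Local Notation resf := (resf r).
Local Notation muf := (muf r).
Local Notation L := (Lpar r).

Fixpoint harm (c : 'I_3 -> R) w : 'I_3 -> R :=
  if w is p :: w' then harm (hstep p c) w' else c.

(** Peeling letters from the front of the word makes the self-similarity of the integral hold by
    definition at every level. *)
Fixpoint riemann_sum (m : nat) f : R :=
  if m is m'.+1 then \sum_p muf p * riemann_sum m' (pull p f) else (\sum_i f [::] i) / 3.

Lemma pull_harm p c : pull p (harm c) = harm (hstep p c).
Proof. by []. Qed.

Lemma hstep_linS p a (c d : 'I_3 -> R) :
  hstep p (fun k => c k + a * d k) = fun i => hstep p c i + a * hstep p d i.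
Proof.
apply/funext => i; rewrite !hstepE mulr_sumr -big_split /=.
by apply: eq_bigr => k _; ring.
Qed.

Lemma harm_linS a (c d : 'I_3 -> R) :
  harm (fun k => c k + a * d k) = linS a (harm c) (harm d).
Proof.
apply: sampleP => w i; elim: w c d => //= p w IH c d.
by rewrite hstep_linS IH.
Qed.

Lemma hstep_cst p a : hstep p (fun=> a) = fun=> a.
Proof.
apply/funext => i; rewrite hstepE -mulr_suml -mulr_suml sum_hnum.
by rewrite divff ?mul1r // lt0r_neq0 // Dpar_gt0.
Qed.

Lemma harm_cst a : harm (fun=> a) = fun _ _ => a.
Proof. by apply: sampleP => w i; elim: w => //= p w IH; rewrite hstep_cst. Qed.

Lemma hcoef_ge0 p i k : 0 <= hnum r p i k / Dpar r.
Proof. by rewrite divr_ge0 ?hnum_ge0 // ltW // Dpar_gt0. Qed.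

Lemma hstep_le p (c d : 'I_3 -> R) i :
  (forall k, c k <= d k) -> hstep p c i <= hstep p d i.
Proof.
by move=> cd; apply: ler_sum => k _; rewrite ler_wpM2l ?hcoef_ge0.
Qed.

Lemma harm_le (c d : 'I_3 -> R) w i :
  (forall k, c k <= d k) -> harm c w i <= harm d w i.
Proof.
by elim: w c d => [|p w IH] c d cd //=; apply: IH => k; apply: hstep_le.
Qed.

Lemma harm_itv (c : 'I_3 -> R) x y w i :
  (forall k, x <= c k <= y) -> x <= harm c w i <= y.
Proof.
move=> cxy; apply/andP; split.
  have := @harm_le (fun=> x) c w i _; rewrite harm_cst; apply => k.
  by case/andP: (cxy k).
have := @harm_le c (fun=> y) w i _; rewrite harm_cst; apply => k.
by case/andP: (cxy k).
Qed.

Lemma riemann_sum_linS m a f g : riemann_sum m (linS a f g) = riemann_sum m f + a * riemann_sum m g.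
Proof.
elim: m f g => [|m IH] f g /=; first by rewrite !sum3 /linS; ring.
rewrite mulr_sumr -big_split /=; apply: eq_bigr => p _.
by rewrite -[pull p (linS a f g)]/(linS a (pull p f) (pull p g)) IH; ring.
Qed.

Lemma riemann_sum_cst m a : riemann_sum m (fun _ _ => a) = a.
Proof.
elim: m => [|m IH] /=; first by rewrite sum3; field.
under eq_bigr do rewrite -[pull _ _]/(fun _ _ => a) IH.
by rewrite -mulr_suml sum_muf // mul1r.
Qed.

Lemma riemann_sum_le m f g : (forall w i, size w = m -> f w i <= g w i) -> riemann_sum m f <= riemann_sum m g.
Proof.
elim: m f g => [|m IH] f g fg /=.
  by rewrite ler_wpM2r ?invr_ge0 //; apply: ler_sum => i _; rewrite fg.
apply: ler_sum => p _; rewrite ler_wpM2l ?(ltW (muf_gt0 _ _)) //.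
by apply: IH => w i wm; apply: fg; rewrite /= wm.
Qed.

Definition bounded f (C : R) := forall w k, `|f w k| <= C.
Definition unifc f := forall e : R, 0 < e -> exists m, forall w w' k k',
  (m <= size w)%N -> `|f (w ++ w') k - f w k'| <= e.
Definition integrableS f := forall w c, cvgn (fun m => riemann_sum m (mulS (harm c) (pullw w f))).
(** What the discrete part of the proof retains of a continuous function. No measure on the gasket
    is mentioned: integrals are limits of Riemann sums, and their convergence is deduced from the
    actual integral in [sampling_nice]. *)
Definition nice f := [/\ exists C : R, bounded f C, unifc f & integrableS f].

Lemma nice0 : nice zeroS.
Proof.
split; first by exists 0 => w k; rewrite normr0.
  by move=> e e0; exists 0%N => w v k k' _; rewrite subrr normr0 ltW.
move=> w c; rewrite (_ : (fun m => _) = fun=> 0); first exact: is_cvg_cst.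
apply/funext => m; rewrite (_ : mulS _ _ = fun _ _ => 0) ?riemann_sum_cst //.
by apply: sampleP => v k; rewrite /mulS /pullw /zeroS mulr0.
Qed.

Lemma nice_linS a f g : nice f -> nice g -> nice (linS a f g).
Proof.
move=> [[C fC] uf cf] [[E gE] ug cg]; split.
- exists (C + `|a| * E) => w k; rewrite /linS (le_trans (ler_normD _ _)) //.
  by rewrite lerD // normrM ler_wpM2l.
- move=> e e0; pose e' := e / 2 / (`|a| + 1).
  have a1 : 0 < `|a| + 1 by rewrite ltr_wpDl.
  have e'0 : 0 < e' by rewrite !divr_gt0.
  have [m1 H1] := uf (e / 2) ltac:(by rewrite divr_gt0).
  have [m2 H2] := ug e' e'0.
  exists (maxn m1 m2) => w v k k'; rewrite geq_max => /andP[h1 h2].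
  rewrite /linS (_ : _ - _ = (f (w ++ v) k - f w k') + a * (g (w ++ v) k - g w k')); last ring.
  rewrite (le_trans (ler_normD _ _)) // [leRHS]splitr lerD ?H1 // normrM.
  apply: (@le_trans _ _ ((`|a| + 1) * e')); last by rewrite /e' mulrC divfK ?gt_eqF.
  by rewrite ler_pM // ?H2 // lerDl.
- move=> w c; rewrite (_ : (fun m => _) = (fun m => riemann_sum m (mulS (harm c) (pullw w f)) + a * riemann_sum m (mulS (harm c) (pullw w g)))).
    by apply: is_cvgD; [exact: cf|apply: is_cvgMr; exact: cg].
  apply/funext => m; rewrite -riemann_sum_linS; congr (riemann_sum m _).
  by apply: sampleP => v k; rewrite /mulS /pullw /linS; ring.
Qed.
End Samples.

(** * The discrete Laplacian *)

Section Laplacian.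
Variables (R : realType) (r : R).
Hypothesis r_gt0 : 0 < r.
Implicit Types (u v f g : sample R) (p : cell) (w : seq cell) (a : R).
Implicit Types (c d : 'I_3 -> R).
Local Notation hstep := (hstep r).
Local Notation resf := (resf r).
Local Notation muf := (muf r).
Local Notation L := (Lpar r).
Local Notation harm := (harm r).
Local Notation riemann_sum := (riemann_sum r).
Local Notation nice := (nice r).
Local Notation zeroS := (@zeroS R).
Local Notation delta := (@delta R).

(* The integral of [f] against the harmonic function with boundary values [c]. *)
Definition harm_int c f : R := limn (fun m => riemann_sum m (mulS (harm c) f)).

Lemma nice_pullw w f : nice f -> nice (pullw w f).
Proof.
move=> [[C fC] uf cf]; split; first by exists C => w' k; exact: fC.
  move=> e e0; have [m H] := uf e e0; exists m => w1 w2 k k' mu_word.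
  by rewrite /pullw catA H // size_cat (leq_trans mu_word) // leq_addl.
move=> w1 c; rewrite (_ : pullw w1 _ = pullw (w ++ w1) f); first exact: cf.
by apply: sampleP => v i; rewrite /pullw catA.
Qed.

Lemma nice_pull p f : nice f -> nice (pull p f).
Proof. exact: (@nice_pullw [:: p]). Qed.

Lemma nice_scaleS a f : nice f -> nice (scaleS a f).
Proof. by move=> nf; rewrite scaleS_linS; apply: nice_linS => //; apply: nice0. Qed.

Lemma harm_int_cvg c f : nice f -> (fun m => riemann_sum m (mulS (harm c) f)) @ \oo --> harm_int c f.
Proof. by move=> [_ _ cf]; exact: (cf [::] c). Qed.
Arguments harm_int_cvg c {f} _.

Lemma harm_int_eq c f l : (fun m => riemann_sum m (mulS (harm c) f)) @ \oo --> l -> harm_int c f = l.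
Proof. exact: cvg_lim. Qed.

Lemma harm_int_linS c a f g : nice f -> nice g -> harm_int c (linS a f g) = harm_int c f + a * harm_int c g.
Proof.
move=> nf ng; apply: harm_int_eq.
rewrite (_ : (fun m => _) = (fun m => riemann_sum m (mulS (harm c) f) + a * riemann_sum m (mulS (harm c) g))).
  by apply: cvgD; [|apply: cvgMr]; exact: harm_int_cvg.
apply/funext => m; rewrite -riemann_sum_linS; congr (riemann_sum m _).
by apply: sampleP => w k; rewrite /mulS /linS; ring.
Qed.

Lemma J0 c : harm_int c zeroS = 0.
Proof.
apply: harm_int_eq.
rewrite (_ : (fun m => _) = fun=> 0); first exact: cvg_cst.
apply/funext => m; rewrite (_ : mulS _ _ = fun _ _ => 0) ?riemann_sum_cst //.
by apply: sampleP => v k; rewrite /mulS /zeroS mulr0.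
Qed.

Lemma harm_int_scaleS c a f : nice f -> harm_int c (scaleS a f) = a * harm_int c f.
Proof. by move=> nf; rewrite scaleS_linS harm_int_linS ?J0 ?add0r //; exact: nice0. Qed.

Lemma harm_int_linc a c d f : nice f -> harm_int (fun k => c k + a * d k) f = harm_int c f + a * harm_int d f.
Proof.
move=> nf; apply: harm_int_eq.
rewrite (_ : (fun m => _) = (fun m => riemann_sum m (mulS (harm c) f) + a * riemann_sum m (mulS (harm d) f))).
  by apply: cvgD; [|apply: cvgMr]; exact: harm_int_cvg.
apply/funext => m; rewrite -riemann_sum_linS; congr (riemann_sum m _).
by apply: sampleP => w k; rewrite harm_linS /mulS /linS; ring.
Qed.

(** The recursion of [riemann_sum] passes to the limit, since a shift of the level does not change
    it. *)
Lemma harm_int_step c f : nice f -> harm_int c f = \sum_p muf p * harm_int (hstep p c) (pull p f).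
Proof.
move=> nf; apply: harm_int_eq; rewrite -cvg_shiftS /=.
apply: cvgn_sum => p; apply: cvgMr.
exact: (harm_int_cvg _ (nice_pull p nf)).
Qed.

Lemma Jc0 f : harm_int (fun=> 0) f = 0.
Proof.
rewrite /harm_int (_ : (fun m => _) = fun=> 0) ?lim_cst //.
apply/funext => m; rewrite (_ : mulS _ _ = fun _ _ => 0) ?riemann_sum_cst //.
by apply: sampleP => v k; rewrite /mulS harm_cst // mul0r.
Qed.

Lemma harm_int_sum c f : nice f -> harm_int c f = \sum_k c k * harm_int (delta k) f.
Proof.
move=> nf; rewrite sum3.
rewrite [in LHS](_ : c = fun k => (fun k => (fun k => 0 + c o0 * delta o0 k) k + c o1 * delta o1 k) k + c o2 * delta o2 k).
  by rewrite !harm_int_linc // Jc0 add0r.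
by apply/funext; apply: ord3_ind; rewrite /delta /=; ring.
Qed.

Lemma harm_int_bound k f C : nice f -> bounded f C -> `|harm_int (delta k) f| <= C.
Proof.
move=> nf fC; have dh w i : `|mulS (harm (delta k)) f w i| <= C.
  have /andP[h0 h1] := @harm_itv _ r r_gt0 (delta k) 0 1 w i
    (fun j => ltac:(by rewrite /delta; case: eqP => _; rewrite ?lexx ler01)).
  rewrite /mulS normrM (ger0_norm h0) (le_trans _ (fC w i)) //.
  by rewrite ler_piMl.
rewrite ler_norml; apply/andP; split.
  rewrite /harm_int; apply: limr_ge; first exact: (harm_int_cvg (delta k) nf).
  near=> m; rewrite -(riemann_sum_cst r_gt0 m (- C)); apply: riemann_sum_le => // w i _.
  by have := dh w i; rewrite ler_norml => /andP[].
rewrite /harm_int; apply: limr_le; first exact: (harm_int_cvg (delta k) nf).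
near=> m; rewrite -(riemann_sum_cst r_gt0 m C); apply: riemann_sum_le => // w i _.
by have := dh w i; rewrite ler_norml => /andP[].
Unshelve. all: by end_near. Qed.

(* Gauss-Green: for [c = delta i] this is the normal derivative at [q_i] of a
   function [u] with Laplacian [f], see [normal_lim]. *)
Definition nderiv u f c : R := \sum_i c i * lap (u [::]) i + harm_int c f.

Lemma nderivE u f c : nderiv u f c = \sum_i c i * lap (u [::]) i + harm_int c f.
Proof. by []. Qed.

Lemma nderiv_sum u f c : nice f -> nderiv u f c = \sum_i c i * nderiv u f (delta i).
Proof.
move=> nf; rewrite /nderiv harm_int_sum //.
under [RHS]eq_bigr => i _.
  rewrite mulrDr; under eq_bigr do rewrite mulrC; rewrite sum_delta.
  over.
by rewrite big_split.
Qed.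

Lemma nderiv_linS c a u v f g : nice f -> nice g ->
  nderiv (linS a u v) (linS a f g) c = nderiv u f c + a * nderiv v g c.
Proof.
by move=> nf ng; rewrite /nderiv harm_int_linS // /lap /linS !sum3; ring.
Qed.

Lemma nderiv_scaleS c a u f : nice f -> nderiv (scaleS a u) (scaleS a f) c = a * nderiv u f c.
Proof. by move=> nf; rewrite /nderiv harm_int_scaleS // /lap /scaleS !sum3; ring. Qed.

(** By symmetry [lap] may be moved onto the harmonic factor. At a junction [u] then has one value
    common to both cells, multiplied by a sum that Kirchhoff's law annihilates; only the three
    corners remain. *)
Lemma green c u : compat u ->
  \sum_p (resf p)^-1 * \sum_i hstep p c i * lap (u [:: p]) i =
  \sum_i c i * lap (u [::]) i.
Proof.
move=> [u1 u2].
pose G (x : cell * 'I_3) := u [:: x.1] x.2 * ((resf x.1)^-1 * lap (hstep x.1 c) x.2).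
have -> : \sum_p (resf p)^-1 * \sum_i hstep p c i * lap (u [:: p]) i = \sum_x G x.
  rewrite sum_pair; apply: eq_bigr => p _; rewrite lap_sym mulr_sumr.
  by apply: eq_bigr => i _; rewrite /G /=; ring.
rewrite sum_mate => [|x nx]; last first.
  by rewrite /G (u1 [::] x) -mulrDr lap_hstep // mulr0.
rewrite lap_sym; apply: eq_bigr => i _.
by rewrite /G /= lap_hstep_corner // (u2 [::] i).
Qed.

(** Since [muf p] is [L / resf p], the integral splits with the same weights as the boundary term,
    and each summand is the [nderiv] of a pair rescaled as in [islap_pull]. *)
Lemma nderiv_step u f c : compat u -> nice f ->
  nderiv u f c = \sum_p (resf p)^-1 * nderiv (pull p u) (scaleS L (pull p f)) (hstep p c).
Proof.
move=> cu nf; rewrite /nderiv -(green c cu) (harm_int_step c nf) -big_split /=.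
apply: eq_bigr => p _; rewrite harm_int_scaleS ?mulrDr; last exact: nice_pull.
congr (_ + _); rewrite -(resf_muf r_gt0 p) !mulrA mulVf ?mul1r //.
by rewrite lt0r_neq0 // resf_gt0.
Qed.

Definition flux u f (x : cell * 'I_3) : R :=
  (resf x.1)^-1 * nderiv (pull x.1 u) (scaleS L (pull x.1 f)) (delta x.2).

Definition junct u f : Prop := forall x, ~~ corner x -> flux u f x + flux u f (mate x) = 0.

(** The discrete form of [Delta u = f]: at every junction point of every level the normal
    derivatives in the two adjacent cells cancel. Nothing is imposed at the boundary [V_0]. *)
Definition islap u f : Prop := [/\ compat u, nice f &
  forall w, junct (pullw w u) (scaleS (L ^+ size w) (pullw w f))].

Lemma islap_junct u f : islap u f -> junct u f.
Proof. by move=> [_ _ /(_ [::])]; rewrite expr0 scl1. Qed.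

Lemma islap_pull p u f : islap u f -> islap (pull p u) (scaleS L (pull p f)).
Proof.
move=> [cu nf H]; split; [exact: compat_pull| by apply: nice_scaleS; exact: nice_pull|].
move=> w; have := H (p :: w); rewrite /= exprSr -sclA.
by rewrite (_ : pullw w (scaleS L _) = scaleS L (pullw (p :: w) f)).
Qed.

Lemma islap_linS a u v f g : islap u f -> islap v g -> islap (linS a u v) (linS a f g).
Proof.
move=> [cu nf H] [cv ng K]; split; [exact: compat_linS|exact: nice_linS|].
move=> w x nx.
have fl y : flux (pullw w (linS a u v)) (scaleS (L ^+ size w) (pullw w (linS a f g))) y
  = flux (pullw w u) (scaleS (L ^+ size w) (pullw w f)) y
    + a * flux (pullw w v) (scaleS (L ^+ size w) (pullw w g)) y.
  rewrite /flux; set b := L ^+ _.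
  rewrite (_ : scaleS L _ = linS a (scaleS L (pull y.1 (scaleS b (pullw w f))))
                               (scaleS L (pull y.1 (scaleS b (pullw w g))))); last first.
    by apply: sampleP => w' i; rewrite /scaleS /linS /pull /pullw; ring.
  rewrite (_ : pull y.1 _ = linS a (pull y.1 (pullw w u)) (pull y.1 (pullw w v))) //.
  rewrite nderiv_linS; first ring.
    by apply/nice_scaleS/nice_pull/nice_scaleS/nice_pullw.
  by apply/nice_scaleS/nice_pull/nice_scaleS/nice_pullw.
by rewrite !fl addrACA -mulrDr (H w x nx) (K w x nx) mulr0 addr0.
Qed.

Lemma islap0 : islap zeroS zeroS.
Proof.
split; [by split| exact: nice0|] => w x _.
have z y : flux (pullw w zeroS) (scaleS (L ^+ size w) (pullw w zeroS)) y = 0.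
  rewrite /flux (_ : scaleS _ (pull _ _) = zeroS).
    by rewrite /nderiv J0 addr0 /lap /pull /pullw /zeroS !sum3; ring.
  by apply: sampleP => w' i; rewrite /scaleS /pull /pullw /zeroS !mulr0.
by rewrite !z addr0.
Qed.

Lemma islap_scaleS a u f : islap u f -> islap (scaleS a u) (scaleS a f).
Proof. by move=> uf; rewrite !scaleS_linS; apply: islap_linS => //; exact: islap0. Qed.

(** In the decomposition of [nderiv_step] the weights [hstep p (delta i)] agree on mates, so the
    fluxes cancel at the junctions; at the corners the weights are those of [delta i]. *)
Lemma nderiv_corner u f i : islap u f ->
  nderiv u f (delta i) = (resf (i, i))^-1 * nderiv (pull (i, i) u) (scaleS L (pull (i, i) f)) (delta i).
Proof.
move=> uf; have [cu nf _] := uf; rewrite nderiv_step //.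
pose G x := hstep x.1 (delta i) x.2 * flux u f x.
transitivity (\sum_x G x).
  rewrite sum_pair; apply: eq_bigr => p _.
  rewrite nderiv_sum; last by apply/nice_scaleS/nice_pull.
  by rewrite mulr_sumr; apply: eq_bigr => k _; rewrite /G /flux /=; ring.
rewrite sum_mate => [|x nx]; last first.
  by rewrite /G hstep_mate -mulrDr islap_junct // mulr0.
under eq_bigr => k _ do rewrite /G /= hstep_corner // mulrC.
exact: (sum_delta (fun k => flux u f ((k, k), k)) i).
Qed.

End Laplacian.

(** * Towers of iterated Laplacians *)

Section Towers.
Variables (R : realType) (r : R).
Hypothesis r_gt0 : 0 < r.
Implicit Types (u v f g : sample R) (p : cell) (w : seq cell) (a : R).
Implicit Types (c d : 'I_3 -> R).
Local Notation hstep := (hstep r).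
Local Notation resf := (resf r).
Local Notation muf := (muf r).
Local Notation L := (Lpar r).
Local Notation harm := (harm r).
Local Notation riemann_sum := (riemann_sum r).
Local Notation nice := (nice r).
Local Notation nderiv := (nderiv r).
Local Notation harm_int := (harm_int r).
Local Notation islap := (islap r).
Local Notation zeroS := (@zeroS R).
Local Notation delta := (@delta R).
Local Notation c0 := ((o0, o0) : cell).

Lemma nderiv_iter u f m : islap u f -> nderiv u f (delta o0) = res0 r ^- m *
  nderiv (pullw (nseq m c0) u) (scaleS (L ^+ m) (pullw (nseq m c0) f)) (delta o0).
Proof.
elim: m u f => [|m IH] u f uf; first by rewrite !expr0 invr1 mul1r scl1.
rewrite (nderiv_corner r_gt0 _ uf) (IH _ _ (islap_pull r_gt0 c0 uf)).
rewrite -[resf _]/(res0 r) mulrA -invfM -exprS; congr (_^-1 * nderiv _ _ _).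
by apply: sampleP => w' i; rewrite /scaleS /pullw /pull /= exprSr; ring.
Qed.

Lemma cvgn_geometric_bounded (q C : R) (x : nat -> R) : 0 <= q < 1 ->
  (forall m, `|x m| <= C) -> (fun m => q ^+ m * x m) @ \oo --> (0 : R).
Proof.
move=> /andP[q0 q1] xC.
have g0 : (fun m : nat => q ^+ m) @ \oo --> (0 : R).
  by apply: cvg_expr; rewrite ger0_norm.
apply: (@squeeze_cvgr _ _ _ _ (fun m => q ^+ m * (- C)) (fun m => q ^+ m * C)).
- near=> m; have := xC m; rewrite ler_norml => /andP[h1 h2].
  by rewrite !ler_wpM2l ?exprn_ge0.
- by rewrite -[X in _ --> X](mul0r (- C)); apply: cvgM => //; exact: cvg_cst.
- by rewrite -[X in _ --> X](mul0r C); apply: cvgM => //; exact: cvg_cst.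
Unshelve. all: by end_near. Qed.

(** The rescaled difference at level [m] misses [nderiv] by a bounded integral over the [m]-th
    corner cell times its mass, the [m]-th power of [muf c0], which tends to 0. *)
Lemma normal_lim u f : islap u f ->
  (fun m => res0 r ^- m * lap (u (nseq m c0)) o0) @ \oo --> nderiv u f (delta o0).
Proof.
move=> uf; have [cu nf _] := uf; have [[C fC] _ _] := nf.
have R0 := res0_gt0 r_gt0.
rewrite (_ : (fun m => _) = fun m => nderiv u f (delta o0)
   - muf c0 ^+ m * harm_int (delta o0) (pullw (nseq m c0) f)).
  rewrite -[X in _ --> X]subr0; apply: cvgB; first exact: cvg_cst.
  apply: (@cvgn_geometric_bounded _ C).
    rewrite ltW ?muf_gt0 //= /muf /mu_factor /= /mu0. have rr := r_gt0.
    by rewrite ltr_pdivrMr; lra.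
  move=> m; apply: harm_int_bound => //; first exact: nice_pullw.
  by move=> w k; exact: fC.
apply/funext => m; rewrite (nderiv_iter m uf) nderivE harm_int_scaleS //; last exact: nice_pullw.
under eq_bigr do rewrite mulrC; rewrite sum_delta /pullw cats0.
have -> : muf c0 = (res0 r)^-1 * L.
  by rewrite -(resf_muf r_gt0 c0) mulrA mulVf ?mul1r // lt0r_neq0.
by rewrite [(_ * L) ^+ m]exprMn exprVn; ring.
Qed.

(** Uniqueness by energy. The difference [d] from the harmonic extension vanishes at the three
    corners and has cancelling currents at the junctions, so its energy is 0 and it is constant on
    each cell. *)
Lemma harmonic_V1 u : islap u zeroS -> forall p i, u [:: p] i = hstep p (u [::]) i.
Proof.
move=> uf; have [[cu1 cu2] _ _] := uf; pose c := u [::].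
pose d p i := u [:: p] i - hstep p c i.
have dmate x : d (mate x).1 (mate x).2 = d x.1 x.2.
  by rewrite /d (cu1 [::] x) hstep_mate.
have dcorner i : d (i, i) i = 0 by rewrite /d (cu2 [::] i) hstep_corner // subrr.
have fluxE x : flux r u zeroS x = (resf x.1)^-1 * lap (u [:: x.1]) x.2.
  rewrite /flux (_ : scaleS _ (pull _ _) = zeroS); last first.
    by apply: sampleP => w' i; rewrite /scaleS /pull /zeroS !mulr0.
  rewrite nderivE J0 // addr0; under eq_bigr do rewrite mulrC.
  by rewrite sum_delta.
pose n x := flux r u zeroS x - (resf x.1)^-1 * lap (hstep x.1 c) x.2.
have nE x : n x = (resf x.1)^-1 * lap (d x.1) x.2.
  by rewrite /n fluxE /d /lap !sum3; ring.
have S0 : \sum_p (resf p)^-1 * \sum_i d p i * lap (d p) i = 0.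
  transitivity (\sum_x d x.1 x.2 * n x).
    rewrite sum_pair; apply: eq_bigr => p _; rewrite mulr_sumr.
    by apply: eq_bigr => i _; rewrite nE /=; ring.
  rewrite sum_mate => [|x nx].
    by rewrite big1 // => i _; rewrite dcorner mul0r.
  rewrite dmate -mulrDr /n addrACA (islap_junct uf nx).
  by rewrite add0r -opprD (lap_hstep r_gt0 c nx) oppr0 mulr0.
have dcell p i k : d p i = d p k.
  have : (resf p)^-1 * (\sum_i d p i * lap (d p) i) = 0.
    apply: (psumr_eq0P _ S0) => // p' _; rewrite lap_sqr.
    by rewrite mulr_ge0 ?invr_ge0 ?(ltW (resf_gt0 _ _)) // !addr_ge0 ?sqr_ge0.
  move/eqP; rewrite mulf_eq0 invr_eq0 (gt_eqF (resf_gt0 r_gt0 p)) /= lap_sqr.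
  rewrite !paddr_eq0 ?addr_ge0 ?sqr_ge0 // !sqrf_eq0 !subr_eq0.
  move=> /andP[/andP[/eqP e1 /eqP e2] /eqP e3].
  by elim/ord3_ind: i; elim/ord3_ind: k; congruence.
suff d0 p i : d p i = 0 by move=> p i; apply/eqP; rewrite -subr_eq0; apply/eqP/d0.
(* The cell [(a, b)] shares a vertex with the corner cell [(a, a)], where the constant is the value
   0 at [q_a]. *)
case: p => a b; rewrite (dcell _ _ a).
have [<-|ab] := eqVneq a b; first exact: dcorner.
have := dmate ((a, b), a); rewrite /mate /= [b == a]eq_sym (negbTE ab) /= => <-.
by rewrite (dcell _ _ a).
Qed.

Lemma harmonicP u : islap u zeroS -> u = harm (u [::]).
Proof.
move=> uf; apply: sampleP => w; elim: w u uf => //= p w IH u uf i.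
have := IH (pull p u); rewrite /pull => ->.
  by congr (harm _ w i); apply/funext => k; exact: harmonic_V1.
by have := islap_pull r_gt0 p uf; rewrite (_ : scaleS _ (pull _ _) = zeroS) //; exact: scl0.
Qed.

(* The sequence whose limit is the tangential derivative at [q_0]. *)
Definition tang_seq u : nat -> R := fun m =>
  lambda_skew r ^- m * (u (nseq m c0) o1 - u (nseq m c0) o2).

Lemma lskew_gt0 : 0 < lambda_skew r.
Proof. by rewrite divr_gt0 ?Dpar_gt0 // mulr_gt0. Qed.

(** The origin of [lambda_skew]: in the corner cell the difference of the two values away from [q_0]
    is multiplied by exactly [2 * r / Dpar r]. *)
Lemma tang_seq_harm c : tang_seq (harm c) = fun=> c o1 - c o2.
Proof.
have D0 := Dpar_gt0 r_gt0; have s0 := lskew_gt0.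
apply/funext => m; rewrite /tang_seq; elim: m c => [|m IH] c.
  by rewrite expr0 invr1 mul1r.
rewrite exprS invfM -mulrA [_^-1 * (_ - _)](IH (hstep c0 c)) !hstepE !sum3 /=.
rewrite /lambda_skew; field.
by rewrite !lt0r_neq0 // mulr_gt0.
Qed.

Lemma tang_seq_linS a u v : tang_seq (linS a u v) = fun m => tang_seq u m + a * tang_seq v m.
Proof. by apply/funext => m; rewrite /tang_seq /linS; ring. Qed.

(** A polynomial is carried along with all its iterated Laplacians, because its data at a corner
    involve all of them. *)
Definition tower (U : nat -> sample R) :=
  (forall l, islap (U l) (U l.+1)) /\ exists n, forall l, (n <= l)%N -> U l = zeroS.

(* Values, normal and tangential derivatives at [q_0] of the iterated Laplacians. *)
Definition data (U : nat -> sample R) (x y t : nat -> R) := forall l,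
  [/\ U l [::] o0 = x l, nderiv (U l) (U l.+1) (delta o0) = y l & tang_seq (U l) @ \oo --> t l].

Lemma tower_nice U l : tower U -> nice (U l.+1).
Proof. by move=> [/(_ l)[]]. Qed.

Lemma tower_linS a U V : tower U -> tower V -> tower (fun l => linS a (U l) (V l)).
Proof.
move=> [hU [n Un]] [hV [m Vm]]; split=> [l|]; first exact: islap_linS.
exists (maxn n m) => l; rewrite geq_max => /andP[nl ml].
by rewrite Un // Vm // lin00.
Qed.

Lemma data_linS a U V x y t x' y' t' : tower U -> tower V ->
  data U x y t -> data V x' y' t' ->
  data (fun l => linS a (U l) (V l)) (fun l => x l + a * x' l)
    (fun l => y l + a * y' l) (fun l => t l + a * t' l).
Proof.
move=> tU tV dU dV l; have [U1 U2 U3] := dU l; have [V1 V2 V3] := dV l.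
split; first by rewrite /linS U1 V1.
  by rewrite nderiv_linS ?U2 ?V2 //; exact: tower_nice.
by rewrite tang_seq_linS; apply: cvgD => //; apply: cvgMr.
Qed.

(** Descending induction on the level: once [U l.+1] is zero, [U l] is harmonic, and zero value,
    normal derivative and tangential derivative at [q_0] are three independent linear conditions on
    its three boundary values. *)
Lemma tower_eq0 U : tower U ->
  data U (fun=> 0) (fun=> 0) (fun=> 0) -> forall l, U l = zeroS.
Proof.
move=> [hU [n Un]] dU l; suff: forall k l, (n <= l + k)%N -> U l = zeroS.
  by apply; exact: leq_addl.
elim=> [|k IH] {}l nl; first by apply: Un; rewrite addn0 in nl.
have U1 : U l.+1 = zeroS by apply: IH; rewrite addSnnS.
have uf := hU l; rewrite U1 in uf; have UE := harmonicP uf.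
have [x0 y0] := dU l; rewrite UE tang_seq_harm => /(@lim_uniq _ _ _ _ (cvg_cst _)) t0.
rewrite U1 nderivE J0 // addr0 in y0.
have y1 : lap (U l [::]) o0 = 0.
  by rewrite -y0; under eq_bigr do rewrite mulrC; rewrite sum_delta.
rewrite /lap sum3 in y1.
rewrite UE (_ : U l [::] = fun=> 0); first exact: harm_cst.
by apply/funext; apply: ord3_ind; lra.
Qed.

Lemma tower_eq U V x y t : tower U -> tower V -> data U x y t -> data V x y t ->
  forall l, U l = V l.
Proof.
move=> tU tV dU dV l.
have d0 : data (fun l => linS (-1) (U l) (V l)) (fun=> 0) (fun=> 0) (fun=> 0).
  by move=> k; have := data_linS (-1) tU tV dU dV k; rewrite !mulN1r !subrr.
have e := tower_eq0 (tower_linS (-1) tU tV) d0 l.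
apply: sampleP => w i; apply/eqP; rewrite -subr_eq0; apply/eqP.
by have := congr1 (fun s => s w i) e; rewrite /linS mulN1r.
Qed.

Lemma tower_shift s U : tower U -> tower (fun l => U (l + s)%N).
Proof.
move=> [hU [n Un]]; split=> [l|]; first exact: hU.
by exists n => l nl; apply: Un; rewrite (leq_trans nl) // leq_addr.
Qed.

Lemma data_shift s U x y t : data U x y t ->
  data (fun l => U (l + s)%N) (fun l => x (l + s)%N) (fun l => y (l + s)%N) (fun l => t (l + s)%N).
Proof. by move=> dU l; exact: dU. Qed.

Lemma tower_pull p U : tower U -> tower (fun l => scaleS (L ^+ l) (pull p (U l))).
Proof.
move=> [hU [n Un]]; split=> [l|].
  rewrite exprSr -sclA; apply: islap_scaleS => //; exact: islap_pull.
by exists n => l nl; rewrite Un //; exact: scl0.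
Qed.

(** The map [F_00] fixes [q_0], so it acts diagonally on the data there. On the tangential sequence
    it is a shift by one index, which costs a factor [lambda_skew]. *)
Lemma data_pull U x y t : tower U -> data U x y t ->
  data (fun l => scaleS (L ^+ l) (pull c0 (U l))) (fun l => L ^+ l * x l)
    (fun l => L ^+ l * (res0 r * y l)) (fun l => L ^+ l * (lambda_skew r * t l)).
Proof.
move=> tU dU l; have [x1 y1 t1] := dU l; have hU := tU.1 l; split.
- by rewrite -x1 /scaleS /pull; have [[_ cu] _ _] := hU; rewrite (cu [::] o0).
- rewrite exprSr -sclA nderiv_scaleS //; last by apply/nice_scaleS/nice_pull/tower_nice.
  congr (_ * _); rewrite -y1 (nderiv_corner r_gt0 o0 hU) mulrA mulfV ?mul1r //.
  by rewrite lt0r_neq0 // res0_gt0.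
- rewrite (_ : tang_seq _ = fun m => L ^+ l * (lambda_skew r * tang_seq (U l) m.+1)).
    by apply: cvgMr; apply: cvgMr; move: t1; rewrite -cvg_shiftS.
  apply/funext => m; rewrite /tang_seq /scaleS /pull -[_ :: nseq _ _]/(nseq m.+1 c0).
  rewrite exprS; have := lskew_gt0 => s0.
  by field; rewrite !lt0r_neq0 // ?exprn_gt0.
Qed.

Lemma tower_scaleS a U : tower U -> tower (fun l => scaleS a (U l)).
Proof.
move=> [hU [n Un]]; split=> [l|]; first exact: islap_scaleS.
by exists n => l nl; rewrite Un // scl0.
Qed.

Lemma data_scaleS a U x y t : tower U -> data U x y t ->
  data (fun l => scaleS a (U l)) (fun l => a * x l) (fun l => a * y l) (fun l => a * t l).
Proof.
move=> tU dU l; have [x1 y1 t1] := dU l; split; first by rewrite -x1.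
  by rewrite -y1 nderiv_scaleS //; exact: tower_nice.
rewrite (_ : tang_seq _ = fun m => a * tang_seq (U l) m); first exact: cvgMr.
by apply/funext => m; rewrite /tang_seq /scaleS; ring.
Qed.

End Towers.

(** * Symmetry and nondegeneracy *)

Section Symmetry.
Variables (R : realType) (r : R) (s : 'I_3 -> 'I_3).
Hypothesis r_gt0 : 0 < r.
Hypothesis s_inj : injective s.
Implicit Types (u v f g : sample R) (p : cell) (w : seq cell) (a : R).
Implicit Types (c d : 'I_3 -> R).
Local Notation L := (Lpar r).
Local Notation zeroS := (@zeroS R).
Local Notation delta := (@delta R).

Definition perm_cell p : cell := (s p.1, s p.2).
Definition permS u : sample R := fun w k => u (map perm_cell w) (s k).

Lemma perm_cell_inj : injective perm_cell.
Proof. by move=> [a b] [a' b'] [/s_inj -> /s_inj ->]. Qed.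

(** The entries [hnum] only test equality between indices, hence are invariant under a simultaneous
    renaming. *)
Lemma hstep_perm p c i : hstep r (perm_cell p) c (s i) = hstep r p (c \o s) i.
Proof.
rewrite !hstepE (reindex_inj s_inj); apply: eq_bigr => k _.
case: p => a b; rewrite /hnum /= !(inj_eq s_inj); by [].
Qed.

Lemma harm_perm c : permS (harm r c) = harm r (c \o s).
Proof.
apply: sampleP => w k; elim: w c => //= p w IH c.
rewrite -[LHS]/(permS (harm r (hstep r (perm_cell p) c)) w k) IH.
by congr (harm r _ w k); apply/funext => i; rewrite /= hstep_perm.
Qed.

Lemma muf_perm p : muf r (perm_cell p) = muf r p.
Proof. by rewrite /muf /mu_factor /= (inj_eq s_inj). Qed.

Lemma resf_perm p : resf r (perm_cell p) = resf r p.
Proof. by rewrite /resf /res_factor /= (inj_eq s_inj). Qed.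

Lemma riemann_sum_perm m f : riemann_sum r m (permS f) = riemann_sum r m f.
Proof.
elim: m f => [|m IH] f /=; first by rewrite [in RHS](reindex_inj s_inj).
rewrite [RHS](reindex_inj perm_cell_inj); apply: eq_bigr => p _.
by rewrite muf_perm -(IH (pull (perm_cell p) f)).
Qed.

Lemma pullw_permS w u : pullw w (permS u) = permS (pullw (map perm_cell w) u).
Proof. by apply: sampleP => w' i; rewrite /pullw /permS map_cat. Qed.

Lemma permS_harm_mul c f : mulS (harm r (c \o s)) (permS f) = permS (mulS (harm r c) f).
Proof. by rewrite -harm_perm. Qed.

Lemma harm_int_perm c f : harm_int r (c \o s) (permS f) = harm_int r c f.
Proof.
by rewrite /harm_int; congr (limn _); apply/funext => m; rewrite permS_harm_mul riemann_sum_perm.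
Qed.

Lemma delta_perm i : delta (s i) \o s = delta i.
Proof. by apply/funext => k; rewrite -[LHS]/((s k == s i)%:R) (inj_eq s_inj). Qed.

Lemma nderiv_perm u f i : nderiv r (permS u) (permS f) (delta i) = nderiv r u f (delta (s i)).
Proof.
rewrite !nderivE -delta_perm harm_int_perm; congr (_ + _).
rewrite [RHS](reindex_inj s_inj); apply: eq_bigr => k _.
by rewrite /lap [in RHS](reindex_inj s_inj).
Qed.

Lemma nice_perm f : nice r f -> nice r (permS f).
Proof.
move=> [[C fC] uf cf]; split; first by exists C => w k; exact: fC.
  move=> e e0; have [m H] := uf e e0; exists m => w w' k k' mu_word.
  by rewrite /permS map_cat H // size_map.
move=> w c; pose c' k := c (invF s_inj k).
rewrite (_ : (fun m => _) = (fun m => riemann_sum r m (mulS (harm r c') (pullw (map perm_cell w) f)))).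
  exact: cf.
apply/funext => m; rewrite pullw_permS (_ : c = c' \o s) ?permS_harm_mul ?riemann_sum_perm //.
by apply/funext => k; rewrite /c' /= invF_f.
Qed.

Lemma mate_perm x : mate (perm_cell x.1, s x.2) = (perm_cell (mate x).1, s (mate x).2).
Proof.
by case: x => [[a b] i]; rewrite /mate /= (inj_eq s_inj); case: ifP.
Qed.

Lemma compat_perm u : compat u -> compat (permS u).
Proof.
move=> [u1 u2]; split=> [w x|w i].
  rewrite /permS !map_rcons.
  by have := u1 (map perm_cell w) (perm_cell x.1, s x.2); rewrite mate_perm.
by rewrite /permS !map_rcons u2.
Qed.

Lemma flux_perm u f x : flux r (permS u) (permS f) x = flux r u f (perm_cell x.1, s x.2).
Proof. by rewrite /flux /= resf_perm -nderiv_perm. Qed.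

Lemma islap_perm u f : islap r u f -> islap r (permS u) (permS f).
Proof.
move=> [cu nf H]; split; [exact: compat_perm | exact: nice_perm|].
move=> w x nx; rewrite !pullw_permS.
rewrite (_ : scaleS _ _ = permS (scaleS (L ^+ size (map perm_cell w)) (pullw (map perm_cell w) f))); last first.
  by rewrite size_map.
rewrite !flux_perm -mate_perm; apply: H.
by move: nx; rewrite /corner /= !(inj_eq s_inj).
Qed.

Lemma tower_perm U : tower r U -> tower r (fun l => permS (U l)).
Proof.
move=> [hU [n Un]]; split=> [l|]; first exact: islap_perm.
by exists n => l nl; rewrite Un.
Qed.

End Symmetry.

(** * The zero function has only the zero Laplacian *)

Section Nondegeneracy.
Variables (R : realType) (r : R).
Hypothesis r_gt0 : 0 < r.
Local Notation L := (Lpar r).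

Lemma harm_int_ge (c : 'I_3 -> R) (f : sample R) (K : R) : nice r f ->
  (forall w k, K <= harm r c w k * f w k) -> K <= harm_int r c f.
Proof.
move=> nf H; rewrite /harm_int; apply: limr_ge; first exact: (@harm_int_cvg _ r c f nf).
by near=> m; rewrite -(riemann_sum_cst r_gt0 m K); apply: riemann_sum_le => // w i _; exact: H.
Unshelve. all: by end_near. Qed.

Lemma harm_delta_ge0 i w k : 0 <= harm r (@delta R i) w k.
Proof.
suff /(@harm_itv _ r r_gt0 (@delta R i) 0 1 w k) /andP[] :
  forall j, 0 <= @delta R i j <= 1 by [].
by move=> j; rewrite /delta; case: eqP => _; rewrite ?lexx ler01.
Qed.

(** The smallest entry is [(3 * r ^+ 2 + 14 * r + 15) / Dpar r], which decreases towards the bound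
    1/3 as [r] grows. *)
Lemma hstep_delta_ge i k : 3^-1 <= hstep r (i, i) (@delta R i) k.
Proof.
have D0 := Dpar_gt0 r_gt0; have r0 := r_gt0; have r2 := sqr_ge0 r.
rewrite hstepE sum_delta ler_pdivlMr //.
elim/ord3_ind: i; elim/ord3_ind: k; rewrite /hnum /=; rewrite /Dpar in D0 *; lra.
Qed.

(** The harmonic function vanishes at the other two corners, so it has no positive lower bound on
    the whole gasket. On the cell [(i, i)] it is at least 1/3, and the other cells contribute
    nonnegative amounts. *)
Lemma harm_int_delta_gt0 i f K : 0 < K -> nice r f -> (forall w k, K <= f w k) ->
  0 < harm_int r (@delta R i) f.
Proof.
move=> K0 nf fK; rewrite harm_int_step // (bigD1 (i, i)) //= ltr_pwDl //.
  rewrite mulr_gt0 ?muf_gt0 //; apply: (@lt_le_trans _ _ (3^-1 * K)).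
    by rewrite mulr_gt0.
  apply: harm_int_ge; first exact: nice_pull.
  move=> w k; apply: ler_pM => //; [exact: ltW| |exact: fK].
  have := @harm_le _ r r_gt0 (fun=> 3^-1) (hstep r (i, i) (@delta R i)) w k.
  by rewrite harm_cst //; apply; exact: hstep_delta_ge.
apply: sumr_ge0 => p _; rewrite mulr_ge0 ?(ltW (muf_gt0 _ _)) //.
apply: harm_int_ge; first exact: nice_pull.
move=> w k; rewrite mulr_ge0 //; last by rewrite (le_trans _ (fK _ _)) // ltW.
exact: (harm_delta_ge0 i (p :: w)).
Qed.

(** If [f] were positive at a vertex, it would be at least half that value on a small cell [w1]
    there. At a junction inside [w1] both fluxes would then be integrals of positive functions, and
    could not cancel. *)
Lemma islap_zero_le (f : sample R) w i : compat f -> islap r (@zeroS R) f -> f w i <= 0.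
Proof.
move=> cf uf; have [_ nf H] := uf; have [_ /[swap] _ unif] := nf.
rewrite leNgt; apply/negP => eta0; pose e := f w i / 2.
have e0 : 0 < e by rewrite divr_gt0.
have [m Hm] := unif e e0; pose w1 := w ++ nseq m (i, i).
have fw1 : f w1 i = f w i.
  rewrite /w1; elim: (m) => [|n IH]; first by rewrite cats0.
  rewrite (_ : nseq n.+1 (i, i) = rcons (nseq n (i, i)) (i, i)).
    by rewrite -rcons_cat cf.2.
  by elim: (n) => //= n' ->.
have fge w' k : e <= pullw w1 f w' k.
  have := Hm w1 w' k i; rewrite size_cat size_nseq leq_addl => /(_ isT).
  rewrite ler_norml /pullw fw1 => /andP[+ _]; rewrite /e; lra.
have := H w1 ((o0, o1), o0) isT; rewrite /mate /=.
have L0 := Lpar_gt0 r_gt0.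
have flux_gt0 x : 0 < flux r (pullw w1 (@zeroS R)) (scaleS (L ^+ size w1) (pullw w1 f)) x.
  rewrite /flux mulr_gt0 ?invr_gt0 ?resf_gt0 // nderivE big1 ?add0r => [|k _]; last first.
    by rewrite /lap /pull /pullw /zeroS sum3; ring.
  rewrite harm_int_scaleS //; last by apply/nice_pull/nice_scaleS/nice_pullw.
  rewrite mulr_gt0 //; apply: (@harm_int_delta_gt0 _ _ (L ^+ size w1 * e)).
  - by rewrite mulr_gt0 // exprn_gt0.
  - by apply/nice_pull/nice_scaleS/nice_pullw.
  - by move=> w' k; rewrite /pull /scaleS ler_wpM2l ?exprn_ge0 ?(ltW L0) //; exact: fge.
by move=> /eqP; rewrite gt_eqF // addr_gt0.
Qed.

Lemma islap_zero_uniq (f : sample R) : compat f -> islap r (@zeroS R) f -> f = @zeroS R.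
Proof.
move=> cf uf; apply: sampleP => w i; apply/eqP; rewrite eq_le islap_zero_le //=.
have := @islap_zero_le (scaleS (-1) f) w i.
have := islap_scaleS r_gt0 (-1) uf; rewrite scl0 /scaleS mulN1r oppr_le0.
move=> h1 h2; apply: h2 => //; case: cf => c1 c2.
by split=> *; rewrite ?c1 ?c2.
Qed.

End Nondegeneracy.

(** * Monomials and the junction equations *)

Section Monomials.
Variables (R : realType) (r : R).
Hypothesis r_gt0 : 0 < r.
Implicit Types (u v f g : sample R) (p : cell) (w : seq cell) (a : R).
Implicit Types (c d : 'I_3 -> R).
Local Notation L := (Lpar r).
Local Notation zeroS := (@zeroS R).
Local Notation delta := (@delta R).
Local Notation nderiv := (nderiv r).
Local Notation resf := (resf r).
Local Notation c0 := ((o0, o0) : cell).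

Definition monom (j k : nat) (U : nat -> sample R) : Prop :=
  tower r U /\ data r U (fun l => ((j == l) && (k == 1%N))%:R)
    (fun l => ((j == l) && (k == 2%N))%:R) (fun l => ((j == l) && (k == 3%N))%:R).

Lemma monom_shift j k i U V : (i <= j)%N -> monom j k U -> monom (j - i) k V ->
  forall l, U (l + i)%N = V l.
Proof.
move=> ij [tU dU] [tV dV]; apply: (tower_eq r_gt0 (tower_shift i tU) tV _ dV).
have E l : (j == l + i)%N = (j - i == l)%N by rewrite -[RHS](eqn_add2r i) subnK.
by move=> l; have := dU (l + i)%N; rewrite E.
Qed.

Lemma monom_zero j k l U : monom j k U -> (j < l)%N -> U l = zeroS.
Proof.
move=> [tU dU] jl.
have := @tower_eq0 _ _ r_gt0 _ (tower_shift j.+1 tU) _ (l - j.+1)%N.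
rewrite subnK //; apply => i.
have E : (j == i + j.+1)%N = false by rewrite ltn_eqF // addnS ltnS leq_addl.
by have := dU (i + j.+1)%N; rewrite E.
Qed.

Definition flip (i : 'I_3) : 'I_3 := if i == o0 then o0 else if i == o1 then o2 else o1.

Lemma flipK : involutive flip.
Proof. by apply: ord3_ind. Qed.

Lemma flip_inj : injective flip. Proof. exact: inv_inj flipK. Qed.

Lemma data_flip U x y t : data r U x y t ->
  data r (fun l => permS flip (U l)) x y (fun l => - t l).
Proof.
move=> dU l; have [x1 y1 t1] := dU l; split.
- by rewrite -x1.
- by rewrite (nderiv_perm r flip_inj).
- rewrite (_ : tang_seq _ _ = fun m => - tang_seq r (U l) m); first exact: cvgN.
  apply/funext => m; rewrite /tang_seq /permS.
  rewrite (_ : map _ _ = nseq m c0); last by elim: m => //= m ->.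
  by rewrite -mulrN opprB.
Qed.

Lemma monom_flip j k U : monom j k U -> (1 <= k <= 3)%N ->
  permS flip (U 0%N) = scaleS (if k == 3%N then -1 else 1) (U 0%N).
Proof.
move=> [tU dU] k13; set e := if _ then _ else _.
have := tower_eq r_gt0 (tower_perm flip_inj tU) (tower_scaleS r_gt0 e tU)
   (data_flip dU) _ 0%N; apply => l.
have := data_scaleS r_gt0 e tU dU l; rewrite /e.
by move: k k13 {dU e} => [|[|[|[|k]]]] //= _;
  rewrite ?andbT ?andbF ?mul1r ?mulN1r ?mulr0 ?oppr0.
Qed.

(** For these [k] the data at [q_0] have a single nonzero entry, and it is scaled by [F_00];
    uniqueness turns this into a scaling of the whole function. It accounts for the terms with
    [lambda_sym] and [lambda_skew] in the system. *)
Lemma monom_scale j k U : monom j k U -> (2 <= k <= 3)%N ->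
  pull c0 (U 0%N) = scaleS ((if k == 3%N then lambda_skew r else res0 r) * L ^+ j) (U 0%N).
Proof.
move=> [tU dU] k23; set e := _ * _.
rewrite -[LHS]scl1 -(expr0 L).
apply: (tower_eq r_gt0 (tower_pull r_gt0 c0 tU) (tower_scaleS r_gt0 e tU)
   (data_pull r_gt0 tU dU) _ 0%N) => l.
have := data_scaleS r_gt0 e tU dU l; rewrite /e.
have [<-|jl] := eqVneq j l; last by rewrite /= !mulr0.
by move: k k23 {dU e} => [|[|[|[|k]]]] //= _; rewrite !mulr0 !mulr1 mulrC.
Qed.

Variable M : nat -> nat -> nat -> sample R.
Hypothesis Mmonom : forall j k, (1 <= k <= 3)%N -> monom j k (M j k).

Let tM j k : (1 <= k <= 3)%N -> tower r (M j k).
Proof. by move=> k3; case: (Mmonom j k3). Qed.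

(** Induction on the length: the last nonzero level is harmonic, so its tangential coefficient is a
    difference of two boundary values, and subtracting three monomials removes that level. The
    tangential derivatives of the lower levels are not assumed to converge, hence the existential
    [t]. *)
Lemma expansion n U : tower r U -> (forall l, (n <= l)%N -> U l = zeroS) ->
  exists t : nat -> R, forall w i, U 0%N w i = \sum_(0 <= l < n)
    (U l [::] o0 * M l 1 0 w i + nderiv (U l) (U l.+1) (delta o0) * M l 2 0 w i
     + t l * M l 3 0 w i).
Proof.
elim: n U => [|n IH] U tU Un.
  by exists (fun=> 0) => w i; rewrite big_nil Un.
pose x := U n [::] o0; pose y := nderiv (U n) (U n.+1) (delta o0).
pose t := U n [::] o1 - U n [::] o2.
have UE : U n = harm r (U n [::]).
  by apply: harmonicP => //; have := tU.1 n; rewrite (Un n.+1).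
pose V l := linS (- t) (linS (- y) (linS (- x) (U l) (M n 1 l)) (M n 2 l)) (M n 3 l).
have t1 : tower r (fun l => linS (- x) (U l) (M n 1 l)) by apply: tower_linS => //; exact: tM.
have t2 : tower r (fun l => linS (- y) (linS (- x) (U l) (M n 1 l)) (M n 2 l)).
  by apply: tower_linS => //; exact: tM.
have tV : tower r V by apply: tower_linS => //; exact: tM.
have dUn : data r (fun l => U (l + n)%N) (fun l => (l == 0)%N%:R * x)
    (fun l => (l == 0)%N%:R * y) (fun l => (l == 0)%N%:R * t).
  case=> [|l]; rewrite ?mul1r ?mul0r.
    by split => //; rewrite add0n UE tang_seq_harm //; exact: cvg_cst.
  have h1 : (n < l.+1 + n)%N by rewrite addSn ltnS leq_addl.
  have h2 : (n < l.+2 + n)%N by rewrite addSn ltnS ltnW.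
  rewrite (Un _ h1) (Un _ h2); split => //.
    rewrite nderivE J0 // addr0 big1 // => i _.
    by rewrite /lap /zeroS sum3; ring.
  rewrite (_ : tang_seq _ _ = fun=> 0); first exact: cvg_cst.
  by apply/funext => m; rewrite /tang_seq /zeroS subrr mulr0.
have Vn l : (n <= l)%N -> V l = zeroS.
  move=> nl; rewrite -(subnK nl); move: (l - n)%N => {nl}l.
  apply: (tower_eq0 r_gt0 (tower_shift n tV)) => {}l.
  have dM k (k3 : (1 <= k <= 3)%N) := data_shift n (Mmonom n k3).2.
  have s1 := tower_shift n tU.
  have D1 := data_linS (- x) s1 (tower_shift n (tM n (isT : (1 <= 1 <= 3)%N))) dUn (dM 1%N isT).
  have D2 := data_linS (- y) (tower_shift n t1) (tower_shift n (tM n (isT : (1 <= 2 <= 3)%N))) D1 (dM 2%N isT).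
  have := data_linS (- t) (tower_shift n t2) (tower_shift n (tM n (isT : (1 <= 3 <= 3)%N))) D2 (dM 3%N isT) l.
  have -> : (n == l + n)%N = (l == 0)%N by rewrite -{1}[n]add0n eqn_add2r eq_sym.
  rewrite !andbF !andbT !mulr0 !addr0.
  by rewrite ![_%:R * _]mulrC !mulNr !subrr.
have [t' Ht] := IH V tV Vn.
exists (fun l => if l == n then t else t' l) => w i.
rewrite big_nat_recr //= eqxx -/x -/y.
have := Ht w i; rewrite {1}/V /linS => H.
have -> : U 0%N w i = \sum_(0 <= l < n) (V l [::] o0 * M l 1 0 w i +
  nderiv (V l) (V l.+1) (delta o0) * M l 2 0 w i + t' l * M l 3 0 w i)
  + (x * M n 1 0 w i + y * M n 2 0 w i + t * M n 3 0 w i).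
  by rewrite -H; ring.
(* Below level [n] the subtracted monomials have zero value and zero normal derivative at [q_0], so
   the coefficients of [V] there are those of [U]. *)
congr (_ + _); apply: eq_big_nat => l /andP[_ ln].
have dM k (k3 : (1 <= k <= 3)%N) := (Mmonom n k3).2 l.
have nl : (n == l)%N = false by rewrite gtn_eqF.
have [x1 y1 _] := dM 1%N isT; have [x2 y2 _] := dM 2%N isT; have [x3 y3 _] := dM 3%N isT.
rewrite nl /= in x1 y1 x2 y2 x3 y3.
rewrite (ltn_eqF ln) /V nderiv_linS; [|exact: (@tower_nice _ _ _ l t2)|exact: (@tower_nice _ _ _ l (@tM n 3 isT))].
rewrite nderiv_linS; [|exact: (@tower_nice _ _ _ l t1)|exact: (@tower_nice _ _ _ l (@tM n 2 isT))].
rewrite nderiv_linS; [|exact: (@tower_nice _ _ _ l tU)|exact: (@tower_nice _ _ _ l (@tM n 1 isT))].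
by rewrite /linS x1 x2 x3 y1 y2 y3 !mulr0 !addr0.
Qed.

Local Notation alpha j := (M j 1 0 [::] o1).
Local Notation beta j := (M j 2 0 [::] o1).

Lemma corner_sum n U i : tower r U -> (forall l, (n <= l)%N -> U l = zeroS) ->
  \sum_k U 0%N [::] k - U 0%N [::] i = 2 * \sum_(0 <= l < n)
    (U l [::] i * alpha l + nderiv (U l) (U l.+1) (delta i) * beta l).
Proof.
(* The quantity computed is symmetric in the two other corners, so a transposition serves as the
   rotation bringing [q_i] to [q_0]. *)
move=> tU Un; pose s : 'I_3 -> 'I_3 := tperm o0 i.
have sI : injective s by exact: perm_inj.
have si : s o0 = i by rewrite /s tpermL.
have [|t] := @expansion n (fun l => permS s (U l)) (tower_perm sI tU).
  by move=> l nl; rewrite Un.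
have flipM k (j : nat) (a : bool) : (1 <= k <= 3)%N -> (k == 3%N) = a ->
    M j k 0 [::] o2 = (if a then -1 else 1) * M j k 0 [::] o1.
  move=> k3 ka; have := monom_flip (Mmonom j k3) k3.
  by move=> /(congr1 (fun f : sample R => f [::] o1)); rewrite /permS /scaleS ka.
move=> H; have H1 := H [::] o1; have H2 := H [::] o2.
rewrite (reindex_inj sI) sum3 si -[U 0%N [::] i]/(U 0%N [::] i).
rewrite -[U 0%N [::] (s o1)]/(permS s (U 0%N) [::] o1) -[U 0%N [::] (s o2)]/(permS s (U 0%N) [::] o2).
rewrite -addrA [LHS]addrC addKr H1 H2 -big_split mulr_sumr /=.
apply: eq_bigr => l _; rewrite (flipM 1%N _ false) // (flipM 2%N _ false) //.
rewrite (flipM 3%N _ true) // nderiv_perm // si /permS /= si; ring.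
Qed.

Lemma junction_eq j k x : (1 <= k <= 3)%N -> ~~ corner x ->
  (resf x.1)^-1 * (\sum_i M j k 0 [:: x.1] i - M j k 0 [:: x.1] x.2) +
  (resf (mate x).1)^-1 * (\sum_i M j k 0 [:: (mate x).1] i - M j k 0 [:: (mate x).1] (mate x).2)
  = 2 * ((resf x.1)^-1 + (resf (mate x).1)^-1) *
    \sum_(0 <= i < j.+1) L ^+ i * alpha i * M (j - i) k 0 [:: x.1] x.2.
Proof.
move=> k3 nx; have tU := tM j k3.
have cell_sum (y : cell * 'I_3) : (resf y.1)^-1 * (\sum_i M j k 0 [:: y.1] i - M j k 0 [:: y.1] y.2)
  = 2 * \sum_(0 <= i < j.+1) ((resf y.1)^-1 * (L ^+ i * alpha i * M j k i [:: y.1] y.2)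
       + L ^+ i * beta i * flux r (M j k i) (M j k i.+1) y).
  have := @corner_sum j.+1 _ y.2 (tower_pull r_gt0 y.1 tU) _.
  rewrite expr0 scl1 => ->; last first.
    by move=> l jl; rewrite (monom_zero (Mmonom j k3)) //; exact: scl0.
  rewrite mulrCA; congr (_ * _); rewrite mulr_sumr; apply: eq_bigr => l _.
  (* Of the [l.+1] factors [L], one belongs to [flux] and the remaining [L ^+ l] is common to both
     cells at the junction. *)
  rewrite exprSr -sclA nderiv_scaleS //; last by apply/nice_scaleS/nice_pull/tower_nice.
  by rewrite /flux /scaleS /pull; ring.
rewrite !cell_sum -mulrDr -mulrA; congr (_ * _); rewrite -big_split mulr_sumr /=.
apply: eq_big_nat => l /andP[_ lj].
have [[c1 _] _ _] := tU.1 l.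
have := islap_junct (tU.1 l) nx => /(congr1 (fun z => L ^+ l * beta l * z)).
rewrite mulr0 mulrDr => fl.
have -> : M (j - l) k 0 [:: x.1] x.2 = M j k l [:: x.1] x.2.
  by rewrite -(monom_shift _ (Mmonom j k3) (Mmonom (j - l) k3) 0%N).
by rewrite addrACA fl addr0 (c1 [::] x); ring.
Qed.

Section System.
Variables (k : nat) (k23 : (2 <= k <= 3)%N).
Local Notation e := (if k == 3%N then -1 else 1 : R).
Local Notation kap := (if k == 3%N then lambda_skew r else res0 r).
Local Notation bt j := (M j k 0 [::] o1).
Local Notation va j := (M j k 0 [:: (o0, o1)] o1).
Local Notation vb j := (M j k 0 [:: (o0, o1)] o2).
Local Notation vc j := (M j k 0 [:: (o1, o1)] o0).
Local Notation vd j := (M j k 0 [:: (o1, o0)] o2).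
Local Notation ve j := (M j k 0 [:: (o1, o1)] o2).
Local Notation vf j := (M j k 0 [:: (o1, o2)] o2).

Let k13 : (1 <= k <= 3)%N.
Proof. by case/andP: k23 => h1 ->; rewrite (ltnW h1). Qed.

Lemma monom_mirror j p i :
  M j k 0 [:: (flip p.1, flip p.2)] (flip i) = e * M j k 0 [:: p] i.
Proof.
have := monom_flip (Mmonom j k13) k13.
by move=> /(congr1 (fun f : sample R => f [:: p] i)).
Qed.

Lemma monom_c0 j : M j k 0 [:: c0] o1 = kap * L ^+ j * bt j.
Proof.
have := monom_scale (Mmonom j k13) k23.
by move=> /(congr1 (fun f : sample R => f [::] o1)).
Qed.

Lemma monom_q0 j : M j k 0 [::] o0 = 0.
Proof.
have [-> _ _] := (Mmonom j k13).2 0%N.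
by move: k k23 => [|[|k']]; rewrite ?andbF.
Qed.

(** Both parities are treated together: [e] is the sign under the reflection and [kap] the scaling
    factor at [q_0]. The 12 junctions form 7 orbits under the reflection. At the two on the axis,
    carrying [vb] and [vf], the adjacent cells are mirror images, whence the factor [1 + e]. *)
Lemma monom_system j :
  [/\ e * kap * L ^+ j * bt j + r * va j + r * vb j
       = (2 + 2 * r) * \sum_(0 <= i < j.+1) kap * L ^+ j * alpha i * bt (j - i)%N,
      kap * L ^+ j * bt j + vb j + vc j + vd j
       = 4 * \sum_(0 <= i < j.+1) L ^+ i * alpha i * va (j - i)%N,
      (1 + e) * (kap * L ^+ j * bt j + va j)
       = 4 * \sum_(0 <= i < j.+1) L ^+ i * alpha i * vb (j - i)%N &
      bt j + r * va j + r * vd j + ve j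
       = (2 + 2 * r) * \sum_(0 <= i < j.+1) L ^+ i * alpha i * vc (j - i)%N] /\
  [/\ va j + vc j + ve j + vf j
       = 4 * \sum_(0 <= i < j.+1) L ^+ i * alpha i * vd (j - i)%N,
      bt j + vc j + r * vd j + r * vf j
       = (2 + 2 * r) * \sum_(0 <= i < j.+1) L ^+ i * alpha i * ve (j - i)%N &
      (1 + e) * (vd j + ve j)
       = 4 * \sum_(0 <= i < j.+1) L ^+ i * alpha i * vf (j - i)%N].
Proof.
have [[cU1 cU2] _ _] := (tM j k13).1 0%N.
have cm := cU1 [::]; have cc := cU2 [::]; rewrite /= in cm cc.
pose iv := (res0 r)^-1.
have iv0 : iv != 0 by rewrite invr_eq0 lt0r_neq0 ?res0_gt0.
(* The origin of the two coefficients: where a cell [(i, i)] meets a cell [(i, i')] the weights are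
   [iv] and [r * iv], giving [2 + 2 * r]; at all other junctions both are [r * iv], giving 4. *)
have ivE : (res1 r)^-1 = r * iv.
  have E0 : res0 r = r * res1 r by rewrite /res0 /res1; ring.
  by rewrite /iv E0 [(r * _)^-1]invfM mulrA mulfV ?mul1r // lt0r_neq0.
have riv0 : r * iv != 0 by rewrite mulf_neq0 // lt0r_neq0.
have rf0 i : (resf (i, i))^-1 = iv by rewrite /resf /res_factor eqxx.
have rf1 i i' : i != i' -> (resf (i, i'))^-1 = r * iv.
  by move=> ii'; rewrite /resf /res_factor (negbTE ii').
have E (z x y x' y' : R) : z != 0 -> x' = y' -> z * (x - y) = x' - y' -> x = y.
  move=> z0 -> /eqP; rewrite subrr mulf_eq0 (negbTE z0) /= subr_eq0.
  by move/eqP.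
have q0 : M j k 0 [:: c0] o0 = 0 by rewrite (cc o0) monom_q0.
have q1 : M j k 0 [:: (o1, o1)] o1 = bt j by exact: (cc o1).
have z2 : M j k 0 [:: c0] o2 = e * (kap * L ^+ j * bt j).
  by rewrite -monom_c0 -(monom_mirror j c0 o1).
have n01_0 : M j k 0 [:: (o0, o1)] o0 = kap * L ^+ j * bt j.
  by rewrite -monom_c0 -(cm ((o0, o1), o0)).
have n10_0 : M j k 0 [:: (o1, o0)] o0 = va j by rewrite -(cm ((o1, o0), o0)).
have n10_1 : M j k 0 [:: (o1, o0)] o1 = vc j by rewrite -(cm ((o1, o0), o1)).
have n02_0 : M j k 0 [:: (o0, o2)] o0 = e * (kap * L ^+ j * bt j).
  by rewrite -z2 -(cm ((o0, o2), o0)).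
have n02_1 : M j k 0 [:: (o0, o2)] o1 = vb j by rewrite -(cm ((o0, o2), o1)).
have n02_2 : M j k 0 [:: (o0, o2)] o2 = e * va j by rewrite -(monom_mirror j (o0, o1) o1).
have n12_0 : M j k 0 [:: (o1, o2)] o0 = vd j by rewrite -(cm ((o1, o2), o0)).
have n12_1 : M j k 0 [:: (o1, o2)] o1 = ve j by rewrite -(cm ((o1, o2), o1)).
have n21_0 : M j k 0 [:: (o2, o1)] o0 = e * vd j.
  by rewrite -(monom_mirror j (o1, o0) o2) -(cm ((o2, o1), o0)).
have n21_1 : M j k 0 [:: (o2, o1)] o1 = vf j by rewrite -(cm ((o2, o1), o1)).
have n21_2 : M j k 0 [:: (o2, o1)] o2 = e * ve j.
  by rewrite -(monom_mirror j (o1, o1) o2) -(cm ((o2, o1), o2)).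
have harm_int x (nx : ~~ corner x) := junction_eq j k13 nx.
have := monom_c0; move: (kap) (e) z2 n01_0 n02_0 n02_2 n21_0 n21_2 => kp ee
  z2 n01_0 n02_0 n02_2 n21_0 n21_2 mc0.
split; split.
- have := harm_int ((o0, o0), o1) isT.
  rewrite /mate /= !sum3 /= rf0 rf1 // q0 z2 mc0 n01_0.
  under eq_big_nat => i /andP[_ ij].
    rewrite mc0 (_ : _ * _ = kp * L ^+ j * alpha i * bt (j - i)%N); last first.
      (* Here the values at the junction are themselves [kp * L ^+ (j - i)] times boundary values;
         together with [L ^+ i] this produces a power [L ^+ j] free of [i]. *)
      have -> : L ^+ j = L ^+ (j - i) * L ^+ i by rewrite -exprD subnK.
      ring.
    over.
  by move/(E iv _ _ _ _ iv0); apply; ring.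
- have := harm_int ((o0, o1), o1) isT; rewrite /mate /= !sum3 /= !rf1 // n01_0 n10_0 n10_1.
  by move/(E (r * iv) _ _ _ _ riv0); apply; ring.
- have := harm_int ((o0, o1), o2) isT; rewrite /mate /= !sum3 /= !rf1 // n01_0 n02_0 n02_1 n02_2.
  by move/(E (r * iv) _ _ _ _ riv0); apply; ring.
- have := harm_int ((o1, o1), o0) isT; rewrite /mate /= !sum3 /= rf0 rf1 // q1 n10_0 n10_1.
  by move/(E iv _ _ _ _ iv0); apply; ring.
- have := harm_int ((o1, o0), o2) isT; rewrite /mate /= !sum3 /= !rf1 // n10_0 n10_1 n12_0 n12_1.
  by move/(E (r * iv) _ _ _ _ riv0); apply; ring.
- have := harm_int ((o1, o1), o2) isT; rewrite /mate /= !sum3 /= rf0 rf1 // q1 n12_0 n12_1.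
  by move/(E iv _ _ _ _ iv0); apply; ring.
- have := harm_int ((o1, o2), o2) isT; rewrite /mate /= !sum3 /= !rf1 // n12_0 n12_1 n21_0 n21_1 n21_2.
  by move/(E (r * iv) _ _ _ _ riv0); apply; ring.
Qed.
End System.
End Monomials.

(** * The harmonic monomials and their values on the first level *)

Section InitialValues.
Variables (R : realType) (r : R).
Hypothesis r_gt0 : 0 < r.

Lemma monom0_harm k U : monom r 0 k U ->
  [/\ U 0%N = harm r (U 0%N [::]),
      lap (U 0%N [::]) o0 = (k == 2%N)%:R &
      U 0%N [::] o1 - U 0%N [::] o2 = (k == 3%N)%:R].
Proof.
move=> mU; have [tU dU] := mU; have [x0 y0 t0] := dU 0%N.
have U1 : U 1%N = @zeroS R by exact: (monom_zero r_gt0 mU).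
have UE : U 0%N = harm r (U 0%N [::]).
  by apply: harmonicP => //; have := tU.1 0%N; rewrite U1.
split => //.
  move: y0; rewrite U1 nderivE J0 // addr0 /= => <-.
  by under eq_bigr do rewrite mulrC; rewrite sum_delta.
by move: t0; rewrite UE tang_seq_harm //= => /(@lim_uniq _ _ _ _ (cvg_cst _)).
Qed.

(** With value 0 at [q_0], the data prescribe the sum and the difference of the two other boundary
    values: -1 and 0 for [k = 2], 0 and 1 for [k = 3]. *)
Lemma monom0_values k U : monom r 0 k U -> (2 <= k <= 3)%N -> forall p i,
  U 0%N [:: p] i = hstep r p (fun l : 'I_3 => if l == o0 then 0 else
     if (l == o1) && (k == 3%N) then 1 / 2 else - (1 / 2)) i.
Proof.
move=> mU k23 p i; have [UE y0 t0] := monom0_harm mU.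
have [x0 _ _] := mU.2 0%N.
rewrite UE /=; congr (hstep r p _ i); apply/funext.
move: k k23 {mU UE} x0 y0 t0 => [|[|[|[|k]]]] //= _; rewrite /lap sum3 => x0 y0 t0;
  by apply: ord3_ind => /=; lra.
Qed.

Lemma monom0_q1 k U : monom r 0 k U -> (2 <= k <= 3)%N ->
  U 0%N [::] o1 = if k == 3%N then 1 / 2 else - (1 / 2).
Proof.
move=> mU k23; have [UE y0 t0] := monom0_harm mU.
have [x0 _ _] := mU.2 0%N.
move: k k23 {mU UE} x0 y0 t0 => [|[|[|[|k]]]] //= _; rewrite /lap sum3 => x0 y0 t0; lra.
Qed.

Lemma monom0_init2 U : monom r 0 2 U ->
  [/\ U 0%N [:: (o0, o1)] o1 = - ((3 * r ^+ 2 + 8 * r + 4) / Dpar r),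
      U 0%N [:: (o0, o1)] o2 = - ((3 * r ^+ 2 + 7 * r + 2) / Dpar r) &
      U 0%N [:: (o1, o1)] o0 = - ((6 * r ^+ 2 + 19 * r + 15) / (2 * Dpar r))] /\
  [/\ U 0%N [:: (o1, o0)] o2 = - ((6 * r ^+ 2 + 19 * r + 13) / (2 * Dpar r)),
      U 0%N [:: (o1, o1)] o2 = - ((6 * r ^+ 2 + 21 * r + 15) / (2 * Dpar r)) &
      U 0%N [:: (o1, o2)] o2 = - ((3 * r ^+ 2 + 10 * r + 7) / Dpar r)].
Proof.
move=> mU; have D0 := lt0r_neq0 (Dpar_gt0 r_gt0).
split; split; rewrite (monom0_values mU) // hstepE sum3 /= /Dpar in D0 *; field.
all: by [].
Qed.

Lemma monom0_init3 U : monom r 0 3 U ->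
  [/\ U 0%N [:: (o0, o1)] o1 = (2 * r + 3) / Dpar r,
      U 0%N [:: (o1, o1)] o0 = (9 * r + 15) / (2 * Dpar r),
      U 0%N [:: (o1, o0)] o2 = (5 * r + 9) / (2 * Dpar r) &
      U 0%N [:: (o1, o1)] o2 = (7 * r + 15) / (2 * Dpar r)].
Proof.
move=> mU; have D0 := lt0r_neq0 (Dpar_gt0 r_gt0).
split; rewrite (monom0_values mU) // hstepE sum3 /= /Dpar in D0 *; field.
all: by [].
Qed.

End InitialValues.

(** * Geometry of the gasket *)

Lemma ord3_0 : (0 : 'I_3) = o0. Proof. exact: val_inj. Qed.
Lemma ord3_1 : (1 : 'I_3) = o1. Proof. exact: val_inj. Qed.
Lemma ord3_2 : (2 : 'I_3) = o2. Proof. exact: val_inj. Qed.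

Lemma det22 (R : comNzRingType) (A : 'M[R]_2) :
  \det A = A 0 0 * A 1 1 - A 0 1 * A 1 0.
Proof.
rewrite (expand_det_row _ 0) !big_ord_recl big_ord0 /cofactor !det_mx11 addr0 !mxE.
rewrite (_ : lift 0 0 = 1 :> 'I_2); last exact: val_inj.
rewrite (_ : lift 1 0 = 0 :> 'I_2); last exact: val_inj.
by rewrite /= expr0 expr1 mul1r mulN1r mulrN.
Qed.

Section Barycentric.
Variables (R : realType) (q : 'I_3 -> plane R).
Hypothesis triq : is_triangle q.
Implicit Types (x y z : plane R) (i j : 'I_3) (p : cell).

Let qx i : R := q i 0 0.
Let qy i : R := q i 0 1.
Definition tri_det : R :=
  (qx o1 - qx o0) * (qy o2 - qy o0) - (qy o1 - qy o0) * (qx o2 - qx o0).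

Lemma tri_det_neq0 : tri_det != 0.
Proof.
move: triq; rewrite /is_triangle row_free_unit unitmxE unitfE ord3_2 ord3_1 ord3_0.
set u := q o1 - q o0; set v := q o2 - q o0; rewrite det22.
have u0 k : col_mx u v 0 k = u 0 k.
  by rewrite -(col_mxEu u v 0 k); congr (col_mx u v _ k); exact: val_inj.
have v0 k : col_mx u v 1 k = v 0 k.
  by rewrite -(col_mxEd u v 0 k); congr (col_mx u v _ k); exact: val_inj.
by rewrite !u0 !v0 !mxE.
Qed.

Definition bary1 x : R :=
  ((x 0 0 - qx o0) * (qy o2 - qy o0) - (x 0 1 - qy o0) * (qx o2 - qx o0)) / tri_det.
Definition bary2 x : R :=
  ((qx o1 - qx o0) * (x 0 1 - qy o0) - (qy o1 - qy o0) * (x 0 0 - qx o0)) / tri_det.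
Definition bary i x : R :=
  if i == o0 then 1 - bary1 x - bary2 x else if i == o1 then bary1 x else bary2 x.

Lemma bary_sum x : \sum_i bary i x = 1.
Proof. by rewrite sum3 /bary /=; ring. Qed.

Lemma bary_q i j : bary i (q j) = (i == j)%:R.
Proof.
have := tri_det_neq0; rewrite /bary /bary1 /bary2 => d0.
elim/ord3_ind: i; elim/ord3_ind: j => /=; rewrite /tri_det /qx /qy in d0 *; by field.
Qed.

Lemma bary_F1 i j x : bary i (F1 q j x) = (bary i x + (i == j)%:R) / 2.
Proof.
rewrite -bary_q /bary /bary1 /bary2 /F1 !mxE; have := tri_det_neq0 => d0.
by case: ifP => _; [|case: ifP => _]; field.
Qed.

Lemma bary_inj x y : (forall i, bary i x = bary i y) -> x = y.
Proof.
have d0 := tri_det_neq0.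
have X (z : plane R) : z 0 0 = qx o0 + bary1 z * (qx o1 - qx o0) + bary2 z * (qx o2 - qx o0).
  by rewrite /bary1 /bary2; rewrite /tri_det in d0 *; field.
have Y (z : plane R) : z 0 1 = qy o0 + bary1 z * (qy o1 - qy o0) + bary2 z * (qy o2 - qy o0).
  by rewrite /bary1 /bary2; rewrite /tri_det in d0 *; field.
move=> xy; have b1 := xy o1; have b2 := xy o2; rewrite /bary /= in b1 b2.
apply/rowP => k; have [->|->] : k = 0 \/ k = 1.
- by case: k => [[|[|k]] lt_k] //; [left|right]; apply: val_inj.
- by rewrite !X b1 b2.
- by rewrite !Y b1 b2.
Qed.

Lemma bary_continuous i : continuous (bary i).
Proof.
have c0 k : continuous (fun x : plane R => x 0 k) by exact: coord_continuous.
have cl (a b c : R) : continuous (fun x : plane R => a * x 0 0 + b * x 0 1 + c).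
  move=> x; apply: (@cvgD _ _ _ (nbhs x) _ (fun y : plane R => a * y 0 0 + b * y 0 1) (fun=> c)).
    by apply: cvgD; apply: cvgMr; exact: c0.
  exact: cvg_cst.
have E1 : bary1 = fun x => (qy o2 - qy o0) / tri_det * x 0 0
   + - (qx o2 - qx o0) / tri_det * x 0 1
   + (- qx o0 * (qy o2 - qy o0) + qy o0 * (qx o2 - qx o0)) / tri_det.
  by apply/funext => x; rewrite /bary1; field; exact: tri_det_neq0.
have E2 : bary2 = fun x => - (qy o1 - qy o0) / tri_det * x 0 0
   + (qx o1 - qx o0) / tri_det * x 0 1
   + (- qy o0 * (qx o1 - qx o0) + qx o0 * (qy o1 - qy o0)) / tri_det.
  by apply/funext => x; rewrite /bary2; field; exact: tri_det_neq0.
have C1 : continuous bary1 by rewrite E1; exact: cl.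
have C2 : continuous bary2 by rewrite E2; exact: cl.
move=> x; rewrite /bary; case: (i == o0); last by case: (i == o1); [exact: C1|exact: C2].
apply: (@cvgB _ _ _ (nbhs x) _ (fun y => 1 - bary1 y) bary2); last exact: C2.
by apply: (@cvgB _ _ _ (nbhs x) _ (fun _ : plane R => 1 : R) bary1); [exact: cvg_cst|exact: C1].
Qed.

Definition Fp p x : plane R := F q p.1 p.2 x.

Lemma bary_F i p x :
  bary i (Fp p x) = (bary i x + (i == p.2)%:R + 2 * (i == p.1)%:R) / 4.
Proof. by rewrite /Fp /F !bary_F1; field. Qed.

Lemma Fp_q i : Fp (i, i) (q i) = q i.
Proof.
apply: bary_inj => k; by rewrite bary_F bary_q /=; field.
Qed.

Lemma Fp_mate (x : cell * 'I_3) : Fp (mate x).1 (q (mate x).2) = Fp x.1 (q x.2).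
Proof.
apply: bary_inj => k; rewrite !bary_F !bary_q; case: x => [[a b] i]; rewrite /mate /=.
by have [->|_] := eqVneq b i; rewrite /=; field.
Qed.

Definition Finv p x : plane R := 2 *: (2 *: (x - q p.1) + q p.1 - q p.2) + q p.2.

Lemma FpK p x : Finv p (Fp p x) = x.
Proof. by apply/rowP => k; rewrite /Finv /Fp /F /F1 !mxE; field. Qed.

Lemma FinvK p x : Fp p (Finv p x) = x.
Proof. by apply/rowP => k; rewrite /Finv /Fp /F /F1 !mxE; field. Qed.

Lemma Fp_dist p x y : `|Fp p x - Fp p y| = `|x - y| / 4.
Proof.
rewrite (_ : Fp p x - Fp p y = 4^-1 *: (x - y)).
  by rewrite normrZ ger0_norm ?invr_ge0 // mulrC.
by apply/rowP => k; rewrite /Fp /F /F1 !mxE; field.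
Qed.

Lemma Fp_continuous p : continuous (Fp p).
Proof.
have -> : Fp p = fun x => 4^-1 *: x + Fp p 0.
  by apply/funext => x; apply/rowP => k; rewrite /Fp /F /F1 !mxE; field.
move=> x; apply: (@cvgD _ _ _ (nbhs x) _ (fun y : plane R => 4^-1 *: y) (fun=> Fp p 0)).
  by apply: cvgZr; exact: cvg_id.
exact: cvg_cst.
Qed.

Lemma bary_le1 x i : (forall k, 0 <= bary k x) -> bary i x <= 1.
Proof.
by move=> x0; rewrite -(bary_sum x) (bigD1 i) //= lerDl; exact: sumr_ge0.
Qed.

Lemma bary_vertex x i : (forall k, 0 <= bary k x) -> 1 <= bary i x -> x = q i.
Proof.
move=> x0 x1; have xi : bary i x = 1 by apply/eqP; rewrite eq_le x1 bary_le1.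
apply: bary_inj => k; rewrite bary_q; have [->//|ki] := eqVneq k i.
have := bary_sum x; rewrite (bigD1 i) //= xi (bigD1 k) //= => S1.
have S2 : 0 <= \sum_(j | (j != i) && (j != k)) bary j x by exact: sumr_ge0.
by have := x0 k; lra.
Qed.

(** Finite ramification. Four times a barycentric coordinate of the common point is a number in
    [0, 1] plus 1 for the second letter and 2 for the first; comparing the two addresses forces some
    of these numbers to be 1, that is, [x] and [y] to be vertices. *)
Lemma Fp_junction p p' x y : (forall i, 0 <= bary i x) -> (forall i, 0 <= bary i y) ->
  Fp p x = Fp p' y -> p != p' ->
  exists i, [/\ x = q i, p' = (mate (p, i)).1, y = q (mate (p, i)).2 & ~~ corner (p, i)].
Proof.
move=> x0 y0 e pp'.
have E i : bary i x + (i == p.2)%:R + 2 * (i == p.1)%:R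
         = bary i y + (i == p'.2)%:R + 2 * (i == p'.1)%:R.
  have := congr1 (bary i) e; rewrite !bary_F => /(congr1 ( *%R^~ 4)).
  by rewrite !divfK.
case: p p' pp' {e} E => [a b] [a' b'] /= pp' E.
have [aa|aa] := eqVneq a a'.
  rewrite aa xpair_eqE eqxx /= in pp'; exists b'; rewrite /mate /corner /= (negbTE pp') aa.
  split => //; last by rewrite andbF.
    apply: bary_vertex => //; have := E b'; rewrite aa eqxx [b' == b]eq_sym (negbTE pp') /=.
    by have := y0 b'; lra.
  apply: bary_vertex => //; have := E b; rewrite aa eqxx (negbTE pp') /=.
  by rewrite ?eqxx /=; have := x0 b; lra.
(* At coordinate [a'] the right side is at least 2, which the left side reaches only with the help
   of its second letter. *)
have ba : b = a'.
  apply/eqP; apply: contraT => ba; have := E a'.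
  rewrite [a' == b]eq_sym (negbTE ba) [a' == a]eq_sym (negbTE aa) eqxx.
  by have := y0 a'; have := bary_le1 a' x0; case: (a' == b') => /=; lra.
have ba' : b' = a.
  apply/eqP; apply: contraT => ba'; have := E a.
  rewrite [a == b']eq_sym (negbTE ba') (negbTE aa) eqxx.
  by have := x0 a; have := bary_le1 a y0; case: (a == b) => /=; lra.
exists a'; rewrite ba ba' /mate /corner /= eqxx (negbTE aa); split => //.
  apply: bary_vertex => //; have := E a'; rewrite ba ba' eqxx [a' == a]eq_sym (negbTE aa) /=.
  by have := y0 a'; lra.
apply: bary_vertex => //; have := E a; rewrite ba ba' eqxx (negbTE aa) /=.
by have := x0 a; lra.
Qed.

End Barycentric.

(** * Cells, gluing and cellwise uniform continuity *)

Section GasketFunctions.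
Variables (R : realType) (q : 'I_3 -> plane R) (SG : set (plane R)).
Hypothesis triq : is_triangle q.
Hypothesis gasketSG : is_gasket q SG.
Implicit Types (x y z : plane R) (i j : 'I_3) (p : cell) (w : seq cell).
Implicit Types (f g : plane R -> R) (u : cell -> plane R -> R).
Local Notation Fp := (Fp q).
Local Notation Finv := (Finv q).
Local Notation Fw := (Fword q).
Local Notation bary := (bary q).

Lemma SG_Fp p x : SG x -> SG (Fp p x).
Proof.
move=> Sx; have [_ _ ->] := gasketSG.
by exists p => //; exists x.
Qed.

Lemma SG_cover x : SG x -> exists p y, SG y /\ x = Fp p y.
Proof.
have [_ _ e] := gasketSG; rewrite {1}e => -[p _ [y Sy <-]].
by exists p, y.
Qed.

Lemma SG_Fw w x : SG x -> SG (Fw w x).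
Proof. by elim: w => //= p w IH /IH; exact: SG_Fp. Qed.

Lemma SG_Fw_cover m x : SG x -> exists w y, [/\ size w = m, SG y & x = Fw w y].
Proof.
elim: m x => [|m IH] x Sx; first by exists [::], x.
have [p [y [Sy ->]]] := SG_cover Sx; have [w [z [<- Sz ->]]] := IH y Sy.
by exists (p :: w), z.
Qed.

Lemma Fw_dist w x y : `|Fw w x - Fw w y| = `|x - y| / 4 ^+ size w.
Proof.
elim: w => [|p w IH] /=; first by rewrite expr0 divr1.
by rewrite [LHS](Fp_dist q p) IH exprS invfM; ring.
Qed.

Lemma Fw_cat w w' x : Fw (w ++ w') x = Fw w (Fw w' x).
Proof. by elim: w => //= p w ->. Qed.

Lemma SG_closed : closed SG.
Proof. by have [cSG _ _] := gasketSG; apply: compact_closed => //; exact: norm_hausdorff. Qed.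

Lemma SG_bounded : exists2 C : R, 0 < C & forall x, SG x -> `|x| <= C.
Proof.
have [cSG _ _] := gasketSG; have [M [_ HM]] := compact_bounded cSG.
exists (`|M| + 1); first by rewrite ltr_wpDl.
by apply: HM; rewrite (le_lt_trans (ler_norm _)) // ltrDl.
Qed.

Lemma expn4_le (e C : R) : 0 < e -> exists m, forall n, (m <= n)%N -> C / 4 ^+ n <= e.
Proof.
move=> e0; have /cvgrPdist_le/(_ e e0) [m _ Hm] :
    (fun n => C * (4^-1) ^+ n) @ \oo --> C * 0.
  by apply: cvgMr; apply: cvg_expr; rewrite ger0_norm // invf_lt1 // ltr1n.
exists m => n mn; have := Hm n mn; rewrite mulr0 sub0r normrN exprVn.
exact: le_trans (ler_norm _).
Qed.

Lemma SG_q i : SG (q i).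
Proof.
have [_ [x Sx] _] := gasketSG.
apply: (@closed_cvg _ _ \oo _ (fun m => Fw (nseq m (i, i)) x) SG SG_closed).
  by near=> m; exact: SG_Fw.
apply/cvgrPdist_le => e e0; have [m Hm] := expn4_le `|q i - x| e0.
exists m => // n /= mn.
have <- : Fw (nseq n (i, i)) (q i) = q i.
  by elim: (n) => //= n' ->; exact: (Fp_q triq).
by rewrite Fw_dist size_nseq Hm.
Unshelve. all: by end_near. Qed.

(** At a point of the gasket where a barycentric coordinate is minimal, self-similarity shows that
    it is at least a quarter of the minimum; so the minimum is not negative. *)
Lemma SG_bary_ge0 x i : SG x -> 0 <= bary i x.
Proof.
have [cSG [z Sz] _] := gasketSG.
have [c] := compact_EVT_min (ex_intro _ z Sz) cSG
  (continuous_subspaceT (@bary_continuous _ q triq i)).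
rewrite inE => Sc minc Sx; apply: (@le_trans _ _ (bary i c)); last first.
  by apply: minc; rewrite inE.
have [p [y [Sy cE]]] := SG_cover Sc; have := minc y; rewrite inE => /(_ Sy).
have := bary_F triq i p y; rewrite -cE => E.
by have := ler0n R (i == p.2); have := ler0n R (i == p.1); lra.
Qed.

(* Equivalent to continuity on the gasket, see [within_cellwise_uc] and
   [cellwise_uc_within], but manifestly stable under gluing and composition with [F_w]. *)
Definition cellwise_uc g : Prop := forall e : R, 0 < e -> exists m, forall w x y,
  (m <= size w)%N -> SG x -> SG y -> `|g (Fw w x) - g (Fw w y)| <= e.

Lemma cellwise_uc_comp_Fw w g : cellwise_uc g -> cellwise_uc (g \o Fw w).
Proof.
move=> ug e e0; have [m H] := ug e e0; exists m => w' x y mu_word Sx Sy /=.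
by rewrite -!Fw_cat H // size_cat (leq_trans mu_word) // leq_addl.
Qed.

Lemma cellwise_uc_bounded g : cellwise_uc g -> exists2 C : R, 0 < C & forall x, SG x -> `|g x| <= C.
Proof.
move=> ug; have [m H] := ug 1 ltr01.
exists (\sum_(w : m.-tuple cell) `|g (Fw w (q o0))| + 1).
  by rewrite ltr_wpDl // sumr_ge0.
move=> x Sx; have [w [y [sw Sy ->]]] := SG_Fw_cover m Sx.
have -> : g (Fw w y) = g (Fw w (q o0)) + (g (Fw w y) - g (Fw w (q o0))) by ring.
rewrite (le_trans (ler_normD _ _)) // lerD ?H ?sw //; last exact: SG_q.
have tw : size w == m by apply/eqP.
by rewrite (bigD1 (Tuple tw)) //= lerDl sumr_ge0.
Qed.

Lemma cellwise_uc_mul f g : cellwise_uc f -> cellwise_uc g -> cellwise_uc (fun x => f x * g x).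
Proof.
move=> uf ug e e0.
have [C C0 HC] := cellwise_uc_bounded uf; have [E E0 HE] := cellwise_uc_bounded ug.
have [m1 H1] := uf (e / 2 / E) (divr_gt0 (divr_gt0 e0 (ltr0Sn _ 1)) E0).
have [m2 H2] := ug (e / 2 / C) (divr_gt0 (divr_gt0 e0 (ltr0Sn _ 1)) C0).
exists (maxn m1 m2) => w x y; rewrite geq_max => /andP[h1 h2] Sx Sy.
have -> : f (Fw w x) * g (Fw w x) - f (Fw w y) * g (Fw w y) =
  (f (Fw w x) - f (Fw w y)) * g (Fw w x) + f (Fw w y) * (g (Fw w x) - g (Fw w y)) by ring.
rewrite (le_trans (ler_normD _ _)) // [leRHS]splitr !normrM lerD //.
  rewrite -[leRHS](@divfK _ E) ?gt_eqF // ler_pM ?H1 // HE //; exact: SG_Fw.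
rewrite -[leRHS](@divfK _ C) ?gt_eqF // mulrC ler_pM ?H2 // HC //; exact: SG_Fw.
Qed.

Lemma cellwise_uc_sum (h : 'I_3 -> plane R -> R) (c : 'I_3 -> R) :
  (forall i, cellwise_uc (h i)) -> cellwise_uc (fun x => \sum_i c i * h i x).
Proof.
move=> uh e e0; pose K := \sum_i `|c i| + 1.
have K0 : 0 < K by rewrite ltr_wpDl // sumr_ge0.
have /choice[m Hm] := fun i => uh i (e / K) (divr_gt0 e0 K0).
exists (\max_i m i) => w x y mu_word Sx Sy; rewrite -sumrB.
rewrite (le_trans (ler_norm_sum _ _ _)) //.
apply: (@le_trans _ _ (\sum_i `|c i| * (e / K))).
  apply: ler_sum => i _; rewrite -mulrBr normrM ler_wpM2l //.
  by apply: Hm => //; rewrite (leq_trans _ mu_word) // leq_bigmax.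
by rewrite -mulr_suml mulrCA ger_pMr // ler_pdivrMr // mul1r /K lerDl.
Qed.

(** At a point of two cells an arbitrary one is picked; [matching] makes the result independent of
    the choice. The value 0 is a default off the gasket. *)
Definition glue (u : cell -> plane R -> R) x : R :=
  if [pick p | `[< SG (Finv p x) >]] is Some p then u p (Finv p x) else 0.

Definition matching (u : cell -> plane R -> R) : Prop := forall x : cell * 'I_3,
  ~~ corner x -> u (mate x).1 (q (mate x).2) = u x.1 (q x.2).

Lemma glueE u p y : matching u -> SG y -> glue u (Fp p y) = u p y.
Proof.
move=> mu Sy; rewrite /glue; case: pickP => [p' /asboolP Sp'|/(_ p)]; last first.
  by rewrite FpK => /asboolPn.
have [<-|pp'] := eqVneq p p'; first by rewrite FpK.
have e : Fp p y = Fp p' (Finv p' (Fp p y)) by rewrite FinvK.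
have [i [-> p'E -> nc]] := Fp_junction triq (fun i => SG_bary_ge0 i Sy)
  (fun i => SG_bary_ge0 i Sp') e pp'.
by rewrite p'E mu.
Qed.

Lemma cellwise_uc_glue u : matching u -> (forall p, cellwise_uc (u p)) -> cellwise_uc (glue u).
Proof.
move=> mu uu e e0; have /choice[m Hm] := fun p => uu p e e0.
exists (\max_p m p).+1 => -[//|p w] x y mu_word Sx Sy /=.
rewrite !(@glueE u p) //; try exact: SG_Fw.
by apply: Hm => //; apply: (leq_trans _ (mu_word : (\max_p m p <= size w)%N)); exact: leq_bigmax.
Qed.
End GasketFunctions.

(** * Harmonic functions and splines *)

Section HarmonicExtension.
Variables (R : realType) (q : 'I_3 -> plane R) (SG : set (plane R)) (r : R).
Hypothesis triq : is_triangle q.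
Hypothesis gasketSG : is_gasket q SG.
Hypothesis r_gt0 : 0 < r.
Implicit Types (x y z : plane R) (i j : 'I_3) (p : cell) (w : seq cell).
Implicit Types (c : 'I_3 -> R) (g : plane R -> R).
Local Notation Fp := (Fp q).
Local Notation Fw := (Fword q).
Local Notation bary := (bary q).
Local Notation hstep := (hstep r).
Local Notation cellwise_uc := (cellwise_uc q SG).
Local Notation SGq := (SG_q triq gasketSG).
Local Notation SGFw := (SG_Fw gasketSG).

(* Interpolates the harmonic function affinely on the cells of level [m]. *)
Fixpoint harm_approx (m : nat) c : plane R -> R :=
  if m is m'.+1 then glue q SG (fun p => harm_approx m' (hstep p c))
  else fun x => \sum_i c i * bary i x.

Lemma harm_approx_q m c i : harm_approx m c (q i) = c i.
Proof.
elim: m c i => [|m IH] c i /=.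
  under eq_bigr do rewrite bary_q //.
  exact: sum_delta.
rewrite -{1}(Fp_q triq i) (glueE triq gasketSG) ?IH ?hstep_corner //.
  by move=> x _; rewrite !IH hstep_mate.
exact: SGq.
Qed.

Lemma harm_approx_matching m c : matching q (fun p => harm_approx m (hstep p c)).
Proof. by move=> x _; rewrite !harm_approx_q hstep_mate. Qed.

Lemma harm_approx_Fp m c p y : SG y -> harm_approx m.+1 c (Fp p y) = harm_approx m (hstep p c) y.
Proof.
by move=> Sy; rewrite /= (glueE triq gasketSG) //; exact: (@harm_approx_matching m c).
Qed.

Lemma cellwise_uc_bary i : cellwise_uc (bary i).
Proof.
move=> e e0; have [m Hm] := expn4_le 1 e0; exists m => w x y mu_word Sx Sy.
apply: le_trans (Hm _ mu_word).
have -> : bary i (Fw w x) - bary i (Fw w y) = (bary i x - bary i y) / 4 ^+ size w.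
  elim: w {mu_word} => [|p w IH] /=; first by rewrite expr0 divr1.
  rewrite -[F q p.1 p.2 _]/(Fp p _) -[F q p.1 p.2 (Fw w y)]/(Fp p _).
  by rewrite !bary_F // exprS invfM [_ * (4^-1 * _)]mulrCA -IH; field.
rewrite normrM [`|_^-1|]ger0_norm ?invr_ge0 ?exprn_ge0 //.
rewrite ler_wpM2r ?invr_ge0 ?exprn_ge0 //.
have sb z (Sz : SG z) k := SG_bary_ge0 triq gasketSG k Sz.
have := bary_le1 i (sb x Sx); have := bary_le1 i (sb y Sy).
have := sb x Sx i; have := sb y Sy i; rewrite ler_norml; lra.
Qed.

Lemma cellwise_uc_harm_approx m c : cellwise_uc (harm_approx m c).
Proof.
elim: m c => [|m IH] c /=; first by apply: cellwise_uc_sum; exact: cellwise_uc_bary.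
by apply: (cellwise_uc_glue triq gasketSG) => //; exact: harm_approx_matching.
Qed.

Lemma harm_approx_itv m c (lo hi : R) x :
  (forall i, lo <= c i <= hi) -> SG x -> lo <= harm_approx m c x <= hi.
Proof.
elim: m c x => [|m IH] c x cl Sx.
  have b0 k := SG_bary_ge0 triq gasketSG k Sx.
  have e a : a = \sum_i a * bary i x by rewrite -mulr_sumr bary_sum mulr1.
  rewrite [lo in X in X && _]e [hi]e /=; apply/andP; split.
    by apply: ler_sum => i _; rewrite ler_wpM2r //; case/andP: (cl i).
  by apply: ler_sum => i _; rewrite ler_wpM2r //; case/andP: (cl i).
have [p [y [Sy ->]]] := SG_cover gasketSG Sx; rewrite harm_approx_Fp //; apply: IH => // i.
have := @hstep_le _ _ r_gt0 p (fun=> lo) c i; rewrite hstep_cst // => -> /=.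
  have := @hstep_le _ _ r_gt0 p c (fun=> hi) i; rewrite hstep_cst //; apply.
  by move=> k; case/andP: (cl k).
by move=> k; case/andP: (cl k).
Qed.

(* Corner [a] has harmonic weight at least 1/3 at every vertex of [F_a F_b SG]. *)
Lemma hstep_contract p c (lo hi : R) i : (forall k, lo <= c k <= hi) ->
  (c p.1 + 2 * lo) / 3 <= hstep p c i <= (c p.1 + 2 * hi) / 3.
Proof.
have D0 := Dpar_gt0 r_gt0; have r1 := r_gt0; have r2 := sqr_ge0 r.
have H3 : 3^-1 <= hnum r p i p.1 / Dpar r.
  rewrite ler_pdivlMr //; case: p => a b /=.
  by elim/ord3_ind: a; elim/ord3_ind: b; elim/ord3_ind: i; rewrite /hnum /=;
    rewrite /Dpar in D0 *; lra.
have key (d : 'I_3 -> R) : (forall k, 0 <= d k) -> d p.1 / 3 <= hstep p d i.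
  move=> d0; rewrite hstepE (bigD1 p.1) //= ler_wpDr //.
    by apply: sumr_ge0 => k _; rewrite mulr_ge0 // hcoef_ge0.
  by rewrite mulrC ler_wpM2r.
move=> cl; have lc k : lo <= c k by case/andP: (cl k).
have ch k : c k <= hi by case/andP: (cl k).
have pos1 k : 0 <= c k + (-1) * lo by rewrite mulN1r subr_ge0.
have pos2 k : 0 <= hi + (-1) * c k by rewrite mulN1r subr_ge0.
have := key _ pos1; rewrite (hstep_linS r p (-1) c (fun=> lo)) hstep_cst //.
have := key _ pos2; rewrite (hstep_linS r p (-1) (fun=> hi) c) hstep_cst //.
move=> h1 h2.
by apply/andP; split; lra.
Qed.

(** By [hstep_contract] each step shrinks the range of the boundary values by 2/3, in whichever
    cell. After [m] steps both functions lie in the same small interval. *)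
Lemma harm_approx_close m n c (lo hi : R) x : (m <= n)%N -> (forall i, lo <= c i <= hi) ->
  SG x -> `|harm_approx n c x - harm_approx m c x| <= (2 / 3) ^+ m * (hi - lo).
Proof.
elim: m n c lo hi x => [|m IH] n c lo hi x mn cl Sx.
  have /andP[h1 h2] := harm_approx_itv n cl Sx; have /andP[h3 h4] := harm_approx_itv 0 cl Sx.
  by rewrite expr0 mul1r ler_norml; lra.
case: n mn => // n mn; have [p [y [Sy ->]]] := SG_cover gasketSG Sx.
rewrite !harm_approx_Fp // (le_trans (IH _ _ _ _ _ mn (fun i => hstep_contract p i cl) Sy)) //.
by rewrite exprSr -mulrA ler_wpM2l ?exprn_ge0 ?divr_ge0 //; lra.
Qed.

Definition harm_ext c x : R := limn (fun m => harm_approx m c x).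

Definition abs_sum c : R := \sum_k `|c k|.

Lemma abs_sum_itv c i : - abs_sum c <= c i <= abs_sum c.
Proof. by rewrite -ler_norml /abs_sum (bigD1 i) //= lerDl sumr_ge0. Qed.

Lemma exp23_le (e C : R) : 0 < e -> exists m, forall n, (m <= n)%N -> (2 / 3) ^+ n * C <= e.
Proof.
move=> e0; have /cvgrPdist_le/(_ e e0) [m _ Hm] :
    (fun n => C * (2 / 3) ^+ n) @ \oo --> C * 0.
  apply: cvgMr; apply: cvg_expr; rewrite ger0_norm ?divr_ge0 //.
  by rewrite ltr_pdivrMr // mul1r ltr_nat.
exists m => n mn; have := Hm n mn; rewrite mulr0 sub0r normrN mulrC.
exact: le_trans (ler_norm _).
Qed.

Lemma harm_ext_cvg c x : SG x -> (fun m => harm_approx m c x) @ \oo --> harm_ext c x.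
Proof.
move=> Sx; have cv : cauchy ((fun m => harm_approx m c x) @ \oo).
  apply/cauchy_exP => e e0; have e2 : 0 < e / 2 by rewrite divr_gt0.
  have [m Hm] := exp23_le (abs_sum c - - abs_sum c) e2.
  exists (harm_approx m c x); exists m => // n /= mn; rewrite -ball_normE /=.
  rewrite distrC (le_lt_trans (harm_approx_close mn (abs_sum_itv c) Sx)) //.
  by rewrite (le_lt_trans (Hm _ _)) // ltr_pdivrMr // ltr_pMr // ltr1n.
exact: cauchy_cvg cv.
Qed.

Lemma harm_ext_close m c x : SG x ->
  `|harm_ext c x - harm_approx m c x| <= (2 / 3) ^+ m * (abs_sum c - - abs_sum c).
Proof.
move=> Sx; have cv : (fun n => `|harm_approx n c x - harm_approx m c x|) @ \oo --> `|harm_ext c x - harm_approx m c x|.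
  by apply: cvg_norm; apply: cvgB; [exact: harm_ext_cvg|exact: cvg_cst].
rewrite -(cvg_lim _ cv) //; apply: limr_le; first by apply/cvg_ex; eexists; exact: cv.
by near=> n; apply: harm_approx_close => //; [near: n; exists m | exact: abs_sum_itv].
Unshelve. all: by end_near. Qed.

Lemma harm_ext_q c i : harm_ext c (q i) = c i.
Proof.
rewrite /harm_ext (_ : (fun m => _) = fun=> c i) ?lim_cst //.
by apply/funext => m; rewrite harm_approx_q.
Qed.

Lemma harm_ext_Fp c p y : SG y -> harm_ext c (Fp p y) = harm_ext (hstep p c) y.
Proof.
move=> Sy; have := @harm_ext_cvg c _ (SG_Fp gasketSG p Sy); rewrite -cvg_shiftS.
move=> h1; apply: (lim_uniq h1).
rewrite (_ : (fun m => _) = (fun m => harm_approx m (hstep p c) y)); first exact: harm_ext_cvg.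
by apply/funext => m; rewrite /= -harm_approx_Fp.
Qed.

Lemma cellwise_uc_harm_ext c : cellwise_uc (harm_ext c).
Proof.
move=> e e0; have e3 : 0 < e / 3 by rewrite divr_gt0.
have [m /(_ m (leqnn m)) Hm] := exp23_le (abs_sum c - - abs_sum c) e3.
have [n Hn] := cellwise_uc_harm_approx m c e3; exists n => w x y nw Sx Sy.
have := Hn w x y nw Sx Sy.
have := le_trans (harm_ext_close m c (SGFw w Sx)) Hm.
have := le_trans (harm_ext_close m c (SGFw w Sy)) Hm.
by rewrite !ler_norml => /andP[? ?] /andP[? ?] /andP[? ?]; apply/andP; split; lra.
Qed.

Definition sampling g : sample R := fun w i => g (Fw w (q i)).

Lemma sampling_harm_ext c : sampling (harm_ext c) = harm r c.
Proof.
apply: sampleP => w i; rewrite /sampling; elim: w c => [|p w IH] c /=; first exact: harm_ext_q.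
by rewrite -IH -harm_ext_Fp //; apply: SGFw; exact: SGq.
Qed.

(* Interpolates the values of [g] at the vertices of level [n], harmonically on each
   cell of that level. *)
Fixpoint spline (n : nat) g : plane R -> R :=
  if n is n'.+1 then glue q SG (fun p => spline n' (g \o Fp p)) else harm_ext (g \o q).

Lemma spline_q n g i : spline n g (q i) = g (q i).
Proof.
elim: n g i => [|n IH] g i /=; first by rewrite harm_ext_q.
rewrite -{1}(Fp_q triq i) (glueE triq gasketSG) ?IH /= ?(Fp_q triq) //.
  by move=> x _; rewrite !IH /= (Fp_mate triq).
exact: SGq.
Qed.

Lemma spline_matching n g : matching q (fun p => spline n (g \o Fp p)).
Proof. by move=> x _; rewrite !spline_q /= (Fp_mate triq). Qed.

Lemma spline_Fp n g p y : SG y -> spline n.+1 g (Fp p y) = spline n (g \o Fp p) y.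
Proof.
by move=> Sy; rewrite /= (glueE triq gasketSG) //; exact: (@spline_matching n g).
Qed.

Lemma cellwise_uc_spline n g : cellwise_uc (spline n g).
Proof.
elim: n g => [|n IH] g /=; first exact: cellwise_uc_harm_ext.
by apply: (cellwise_uc_glue triq gasketSG) => //; exact: spline_matching.
Qed.

Lemma sampling_spline n g p : pull p (sampling (spline n.+1 g)) = sampling (spline n (g \o Fp p)).
Proof.
apply: sampleP => w i; rewrite /pull /sampling [Fw _ _]/= -[F _ _ _ _]/(Fp p _) spline_Fp //.
by apply: SGFw; exact: SGq.
Qed.

End HarmonicExtension.

(** * Comparison with continuity in the topology of the plane *)

Section CellwiseContinuity.
Variables (R : realType) (q : 'I_3 -> plane R) (SG : set (plane R)).
Hypothesis triq : is_triangle q.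
Hypothesis gasketSG : is_gasket q SG.
Implicit Types (x y z : plane R) (i j : 'I_3) (p : cell) (w : seq cell).
Implicit Types (g : plane R -> R).
Local Notation Fp := (Fp q).
Local Notation Fw := (Fword q).
Local Notation cellwise_uc := (cellwise_uc q SG).

Lemma Fw_continuous w : continuous (Fw w).
Proof.
elim: w => [|p w IH] x; first exact: cvg_id.
by apply: (@continuous_comp _ _ _ (Fw w) (Fp p)); [exact: IH|exact: Fp_continuous].
Qed.

Lemma cell_closed w : closed (Fw w @` SG).
Proof.
have [cSG _ _] := gasketSG.
apply: compact_closed; first exact: norm_hausdorff.
apply: continuous_compact => //; apply: continuous_subspaceT; exact: Fw_continuous.
Qed.

(** Heine-Cantor, with [C + C] as a bound for the diameter of the gasket, so that a cell of level
    [m] has diameter at most [(C + C) / 4 ^+ m]. *)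
Lemma within_cellwise_uc g : {within SG, continuous g} -> cellwise_uc g.
Proof.
move=> /subspace_continuousP cg e e0; have e2 : 0 < e / 2 by rewrite divr_gt0.
have [cSG _ _] := gasketSG; have [C C0 HC] := SG_bounded gasketSG.
have /near_covering_withinP nc := (compact_near_coveringP SG).1 cSG.
pose P (m : nat) x := forall y, SG y -> `|x - y| <= (C + C) / 4 ^+ m -> `|g x - g y| <= e.
have [m _ Hm] : \forall m \near \oo, SG `<=` P m.
  apply: nc => x Sx; have /cvgrPdist_le/(_ _ e2) := cg x Sx.
  move=> /nbhs_ballP [d /= d0 Hd].
  have d2 : 0 < d / 2 / 2 by rewrite !divr_gt0.
  have [m Hm] := expn4_le (C + C) d2.
  exists (ball x (d / 2), [set n | (m <= n)%N]).
    split; last by exists m.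
    by apply/nbhs_ballP; exists (d / 2); rewrite //= divr_gt0.
  move=> [x' n] [/= bx' mn] Sx' y Sy xy.
  rewrite -ball_normE /= in bx'.
  have h1 : `|g x - g x'| <= e / 2.
    apply: Hd => //; rewrite -ball_normE /=; apply: (lt_le_trans bx').
    by rewrite ler_pdivrMr // ler_pMr // ler1n.
  have h2 : `|g x - g y| <= e / 2.
    apply: Hd => //; rewrite -ball_normE /=.
    have -> : x - y = (x - x') + (x' - y) by rewrite addrA subrK.
    rewrite (le_lt_trans (ler_normD _ _)) // [ltRHS]splitr ltr_leD //.
    by rewrite (le_trans xy) // (le_trans (Hm _ mn)) // ler_pdivrMr // ler_pMr ?ler1n // divr_gt0.
  have -> : g x' - g y = (g x - g y) - (g x - g x') by ring.
  by rewrite (le_trans (ler_normB _ _)) // [leRHS]splitr lerD.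
exists m => w x y mu_word Sx Sy.
apply: (Hm _ mu_word (Fw w x) (SG_Fw gasketSG w Sx)); first exact: SG_Fw.
rewrite Fw_dist ler_wpM2r ?invr_ge0 ?exprn_ge0 //.
by rewrite (le_trans (ler_normB _ _)) // lerD ?HC.
Qed.

(** A point may lie in several cells. The cells of level [m] that avoid [x] form a closed set [B],
    and any point of the gasket outside [B] lies in a cell together with [x]. *)
Lemma cellwise_uc_within g : cellwise_uc g -> {within SG, continuous g}.
Proof.
move=> ug; apply/subspace_continuousP => x Sx; apply/cvgrPdist_le => e e0.
have [m Hm] := ug e e0.
pose B := \bigcup_(w in [set w : m.-tuple cell | ~ (Fw w @` SG) x]) (Fw w @` SG).
have cB : closed B by apply: closed_bigcup => [|w _]; [exact: finite_finset|exact: cell_closed].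
have oB : open (~` B) by exact: closed_openC.
have Bx : (~` B) x by move=> [w /= nw].
have : nbhs x (~` B) by apply: open_nbhs_nbhs.
apply: filterS => y nBy Sy.
have [w [z [sw Sz yE]]] := SG_Fw_cover gasketSG m Sy.
have tw : size w == m by apply/eqP.
have [x' Sx' xE] : (Fw w @` SG) x.
  apply: contrapT => nx; apply: nBy; exists (Tuple tw) => //=.
  by exists z.
by rewrite -xE yE Hm // sw.
Qed.

Lemma cellwise_uc_comb (a b : R) f g : cellwise_uc f -> cellwise_uc g -> cellwise_uc (fun x => a * f x + b * g x).
Proof.
move=> uf ug; pose h i := if i == o0 then f else if i == o1 then g else fun=> 0.
have uh i : cellwise_uc (h i).
  rewrite /h; case: eqP => // _; case: eqP => // _ e e0; exists 0%N => w x y *.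
  by rewrite subrr normr0 ltW.
pose c (i : 'I_3) := if i == o0 then a else b.
rewrite (_ : (fun x => _) = fun x => \sum_i c i * h i x); first exact: cellwise_uc_sum.
by apply/funext => x; rewrite sum3 /c /h /= mulr0 addr0.
Qed.

Lemma cellwise_uc_scaleS (a : R) g : cellwise_uc g -> cellwise_uc (fun x => a * g x).
Proof.
move=> ug; rewrite (_ : (fun x => _) = fun x => a * g x + 0 * g x); first exact: cellwise_uc_comb.
by apply/funext => x; rewrite mul0r addr0.
Qed.

Lemma cellwise_uc_cst (a : R) : cellwise_uc (fun=> a).
Proof. by move=> e e0; exists 0%N => *; rewrite subrr normr0 ltW. Qed.

End CellwiseContinuity.

Lemma sum_tupleS (V : nmodType) m (G : seq cell -> V) :
  \sum_(w : m.+1.-tuple cell) G w = \sum_p \sum_(w : m.-tuple cell) G (p :: w).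
Proof.
rewrite pair_big /= (reindex (fun x : cell * m.-tuple cell => [tuple of x.1 :: x.2])) //.
exists (fun w : m.+1.-tuple cell => (thead w, [tuple of behead w])) => [[p w] _|w _] /=.
  by congr (_, _); apply: val_inj.
by rewrite [w in RHS]tuple_eta; apply: val_inj.
Qed.

Lemma sum_tuple0 (V : nmodType) (G : seq cell -> V) : \sum_(w : 0.-tuple cell) G w = G [::].
Proof.
rewrite (bigD1 [tuple]) //= big1 ?addr0 // => w.
by rewrite (tuple0 w) => /eqP; case; apply: val_inj.
Qed.

(** * Integration on the gasket *)

Section SelfSimilarIntegral.
Variables (R : realType) (q : 'I_3 -> plane R) (SG : set (plane R)) (r : R).
Variable mu : probability (borel_plane R) R.
Hypothesis triq : is_triangle q.
Hypothesis gasketSG : is_gasket q SG.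
Hypothesis r_gt0 : 0 < r.
Hypothesis ssmu : is_selfsimilar_measure q SG r mu.
Implicit Types (x y z : plane R) (i j : 'I_3) (p : cell) (w : seq cell).
Implicit Types (g : plane R -> R).
Local Notation Fp := (Fp q).
Local Notation Fw := (Fword q).
Local Notation cellwise_uc := (cellwise_uc q SG).
Local Notation sampling := (sampling q).
Local Notation muf := (muf r).
Local Notation riemann_sum := (riemann_sum r).

Lemma borel_open (A : set (plane R)) : open A -> measurable (A : set (borel_plane R)).
Proof. by move=> oA; apply: sub_sigma_algebra. Qed.

Lemma borel_closed (A : set (plane R)) : closed A -> measurable (A : set (borel_plane R)).
Proof. by move=> /closed_openC/borel_open/measurableC; rewrite setCK. Qed.

Let mSG : measurable (SG : set (borel_plane R)).
Proof. exact: borel_closed (SG_closed gasketSG). Qed.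

Lemma cellwise_uc_measurable g : cellwise_uc g -> measurable_fun (SG : set (borel_plane R)) (g : borel_plane R -> R).
Proof.
move=> ug; have /continuousP cg := cellwise_uc_within gasketSG ug.
apply: (measurability _ (RGenOpens.measurableE R)).
move=> _ [_ [a [b ->] <-]].
have /cg/open_subspaceP [V oV VD] : open `]a, b[%classic by exact: interval_open.
by rewrite setIC -VD; apply: measurableI => //; exact: borel_open.
Qed.

Definition mu_word w : R := \prod_(p <- w) muf p.

Lemma mu_cell w : mu (Fw w @` SG) = (mu_word w)%:E.
Proof.
elim: w => [|p w IH]; first by rewrite /mu_word big_nil image_id ssmu.1.
have -> : Fw (p :: w) @` SG = F q p.1 p.2 @` (Fw w @` SG).
  by rewrite -image_comp.
rewrite ssmu.2 ?IH; first by rewrite /mu_word big_cons EFinM.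
- by apply: borel_closed; exact: cell_closed.
- by move=> _ [x Sx <-]; exact: SG_Fw.
Qed.

Lemma riemann_sum_tuple m f : riemann_sum m f = \sum_(w : m.-tuple cell) mu_word w * ((\sum_i f w i) / 3).
Proof.
elim: m f => [|m IH] f /=.
  by rewrite (sum_tuple0 (fun w => mu_word w * ((\sum_i f w i) / 3))) /mu_word big_nil mul1r.
rewrite (@sum_tupleS _ _ (fun w => mu_word w * ((\sum_i f w i) / 3))).
apply: eq_bigr => p _; rewrite IH mulr_sumr; apply: eq_bigr => w _.
by rewrite /mu_word big_cons mulrA.
Qed.

Lemma sum_mu_word m : \sum_(w : m.-tuple cell) mu_word w = 1.
Proof.
have := riemann_sum_cst r_gt0 m 1; rewrite riemann_sum_tuple => <-; apply: eq_bigr => w _.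
by rewrite sum3 -[X in X = _]mulr1; congr (_ * _); field.
Qed.

(** The function is dominated by a step function on the cells. Cells overlap at junction points, but
    for nonnegative terms the overlap only increases the sum; an upper bound thus never has to know
    that junction points have measure zero. *)
Lemma integral_le_riemann_sum m g (e : R) : cellwise_uc g -> (forall x, SG x -> 0 <= g x) -> 0 <= e ->
  (forall w x y, size w = m -> SG x -> SG y -> `|g (Fw w x) - g (Fw w y)| <= e) ->
  (\int[mu]_(x in SG) (g x)%:E <= (riemann_sum m (sampling g) + e)%:E)%E.
Proof.
move=> ug g0 e0 He.
pose c w := (\sum_i g (Fw w (q i))) / 3 + e.
have c0 w : 0 <= c w.
  rewrite addr_ge0 // divr_ge0 // sumr_ge0 // => i _; apply: g0.
  by exact: (SG_Fw gasketSG w (SG_q triq gasketSG i)).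
pose h (w : m.-tuple cell) (x : borel_plane R) : \bar R := ((c w)%:E * (\1_(Fw w @` SG) x)%:E)%E.
have mI (w : m.-tuple cell) : measurable ((Fw w @` SG) : set (borel_plane R)).
  by apply: borel_closed; exact: cell_closed.
have mi (w : m.-tuple cell) : measurable_fun (SG : set (borel_plane R))
    (fun x : borel_plane R => (\1_(Fw w @` SG) x)%:E : \bar R).
  by apply/measurable_EFinP; exact: measurable_indic.
have mh (w : m.-tuple cell) : measurable_fun (SG : set (borel_plane R)) (h w).
  by apply: measurable_funeM; exact: mi.
have h0 (w : m.-tuple cell) x : (0 <= h w x)%E by rewrite mule_ge0 // lee_fin.
apply: (@le_trans _ _ (\int[mu]_(x in SG) (\sum_(w : m.-tuple cell) h w x))%E).
  apply: ge0_le_integral => //.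
  - by apply/measurable_EFinP; exact: cellwise_uc_measurable.
  - by apply: emeasurable_sum => w; exact: mh.
  - move=> x Sx; have [w [y [sw Sy xE]]] := SG_Fw_cover gasketSG m Sx.
    have tw : size w == m by apply/eqP.
    rewrite (bigD1 (Tuple tw)) //= -[leLHS]adde0 leeD //; last exact: sume_ge0.
    rewrite /h indicE mem_set; last by exists y.
    rewrite mule1 lee_fin xE /c sum3 /=.
    have X i : g (Fw w y) <= g (Fw w (q i)) + e.
      rewrite -lerBlDl (le_trans (ler_norm _)) // He //; exact: (SG_q triq gasketSG i).
    by have := X o0; have := X o1; have := X o2; lra.
rewrite ge0_integral_sum //.
have -> : (\sum_(w : m.-tuple cell) \int[mu]_(x in SG) h w x)%E =
   (\sum_(w : m.-tuple cell) (c w * mu_word w)%:E)%E.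
  apply: eq_bigr => w _; rewrite ge0_integralZl_EFin //.
  rewrite integral_indic // setIidl; first by rewrite EFinM -(mu_cell w).
  by move=> _ [x Sx <-]; exact: SG_Fw.
rewrite sumEFin lee_fin.
have -> : riemann_sum m (sampling g) + e =
    \sum_(w : m.-tuple cell) (mu_word w * ((\sum_i sampling g w i) / 3) + e * mu_word w).
  by rewrite riemann_sum_tuple big_split /= -mulr_sumr sum_mu_word mulr1.
by apply: ler_sum => w _; rewrite le_eqVlt; apply/orP; left; apply/eqP; rewrite /c /sampling; ring.
Qed.

Lemma cellwise_uc_integrable g : cellwise_uc g -> mu.-integrable SG (EFin \o (g : borel_plane R -> R)).
Proof.
move=> ug; apply: measurable_bounded_integrable => //.
- exact: le_lt_trans (probability_le1 mu mSG) (ltry _).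
- exact: cellwise_uc_measurable.
- have [C C0 HC] := cellwise_uc_bounded triq gasketSG ug.
  exists C; split; first exact: num_real.
  by move=> M CM x Sx; exact: le_trans (HC x Sx) (ltW CM).
Qed.

Lemma Rintegral_riemann_sum g : cellwise_uc g ->
  (fun m => riemann_sum m (sampling g)) @ \oo --> (\int[mu]_(x in SG) g x)%R.
Proof.
move=> ug; have [C C0 HC] := cellwise_uc_bounded triq gasketSG ug.
apply/cvgrPdist_le => e e0; have [m0 Hm] := ug e e0; exists m0 => // m /= mm.
(* The one-sided bound for nonnegative functions, applied to [C + g] and to [C - g], gives both
   inequalities. *)
have key (s : R) : s = 1 \/ s = -1 ->
    s * (\int[mu]_(x in SG) g x)%R <= s * riemann_sum m (sampling g) + e.
  move=> s1; pose h x := C * 1 + s * g x.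
  have uh : cellwise_uc h by apply: cellwise_uc_comb => //; exact: cellwise_uc_cst.
  have h0 x : SG x -> 0 <= h x.
    by move=> /HC; rewrite /h ler_norml => /andP[? ?]; case: s1 => ->; lra.
  have := @integral_le_riemann_sum m h e uh h0 (ltW e0) _.
  have -> : (\int[mu]_(x in SG) (h x)%:E)%E = (C + s * (\int[mu]_(x in SG) g x)%R)%:E.
    have fE : (\int[mu]_(x in SG) (h x)%:E)%E = (\int[mu]_(x in SG) h x)%R%:E.
      by rewrite /Rintegral fineK // integrable_fin_num //; exact: cellwise_uc_integrable.
    rewrite fE; congr (_%:E); rewrite /h RintegralD //.
    - rewrite Rintegral_cst // [fine _](congr1 fine ssmu.1) /= !mulr1; congr (_ + _).
      by rewrite RintegralZl //; exact: cellwise_uc_integrable.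
    - by apply: cellwise_uc_integrable; exact: cellwise_uc_cst.
    - by apply: cellwise_uc_integrable; exact: cellwise_uc_scaleS.
  rewrite (_ : sampling h = linS s (fun _ _ => C) (sampling g)); last first.
    by apply: sampleP => w i; rewrite /linS /sampling /h mulr1.
  rewrite riemann_sum_linS riemann_sum_cst // lee_fin -addrA lerD2l; apply => w x y sw Sx Sy.
  rewrite /h opprD addrACA subrr add0r -mulrBr normrM.
  have -> : `|s| = 1 by case: s1 => ->; rewrite ?normrN normr1.
  by rewrite mul1r Hm // sw.
have := key 1 (or_introl erefl); have := key (-1) (or_intror erefl).
by rewrite !mulN1r !mul1r ler_norml => *; apply/andP; split; lra.
Qed.

End SelfSimilarIntegral.

(** * From the weak to the discrete Laplacian *)

Section WeakLaplacian.
Variables (R : realType) (q : 'I_3 -> plane R) (SG : set (plane R)) (r : R).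
Variable mu : probability (borel_plane R) R.
Hypothesis triq : is_triangle q.
Hypothesis gasketSG : is_gasket q SG.
Hypothesis r_gt0 : 0 < r.
Hypothesis ssmu : is_selfsimilar_measure q SG r mu.
Implicit Types (x y z : plane R) (i j : 'I_3) (p : cell) (w : seq cell).
Implicit Types (g : plane R -> R).
Local Notation Fp := (Fp q).
Local Notation Finv := (Finv q).
Local Notation Fw := (Fword q).
Local Notation cellwise_uc := (cellwise_uc q SG).
Local Notation sampling := (sampling q).
Local Notation muf := (muf r).
Local Notation resf := (resf r).
Local Notation riemann_sum := (riemann_sum r).
Local Notation L := (Lpar r).
Local Notation harm := (harm r).
Local Notation hstep := (hstep r).
Local Notation nice := (nice r).
Local Notation nderiv := (nderiv r).
Local Notation harm_int := (harm_int r).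
Local Notation spline := (spline q SG r).
Local Notation harm_ext := (harm_ext q SG r).
Local Notation SGq := (SG_q triq gasketSG).

Fixpoint word_energy (m : nat) (u v : sample R) : R :=
  if m is m'.+1 then \sum_p (resf p)^-1 * word_energy m' (pull p u) (pull p v)
  else \sum_i v [::] i * lap (u [::]) i.

Lemma word_energy_tuple m u v : word_energy m u v = \sum_(w : m.-tuple cell)
  (res_word r w)^-1 * (\sum_i v w i * lap (u w) i).
Proof.
elim: m u v => [|m IH] u v /=.
  rewrite (sum_tuple0 (fun w => (res_word r w)^-1 * (\sum_i v w i * lap (u w) i))) /=.
  by rewrite invr1 mul1r.
rewrite (@sum_tupleS _ _ (fun w => (res_word r w)^-1 * (\sum_i v w i * lap (u w) i))).
apply: eq_bigr => p _; rewrite IH mulr_sumr; apply: eq_bigr => w _.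
by rewrite mulrA -invfM.
Qed.

Lemma graph_energyE m (u v : plane R -> R) :
  graph_energy q r m u v = word_energy m (sampling u) (sampling v).
Proof.
rewrite word_energy_tuple /graph_energy; apply: eq_bigr => w _.
rewrite /lap /sampling !sum3; do 3! rewrite big_mkcond sum3 /=.
ring.
Qed.

Lemma word_energy_harm m c u : compat u -> word_energy m u (harm c) = \sum_i c i * lap (u [::]) i.
Proof.
elim: m c u => [|m IH] c u cu //=.
rewrite -(green r_gt0 c cu); apply: eq_bigr => p _.
by rewrite pull_harm IH //; exact: compat_pull.
Qed.

Fixpoint spline_energy (n : nat) (u : sample R) g : R :=
  if n is n'.+1 then \sum_p (resf p)^-1 * spline_energy n' (pull p u) (g \o Fp p)
  else \sum_i g (q i) * lap (u [::]) i.

Fixpoint spline_int (n : nat) (f : sample R) g : R :=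
  if n is n'.+1 then \sum_p muf p * spline_int n' (pull p f) (g \o Fp p)
  else harm_int (g \o q) f.

(* The weak equation tested against [spline n g], written as the sum over the cells of
   level [n] of their normal derivatives weighted by [g], see [Phi_split]. *)
Fixpoint Phi (n : nat) (u f : sample R) g : R :=
  if n is n'.+1 then
    \sum_p (resf p)^-1 * Phi n' (pull p u) (scaleS L (pull p f)) (g \o Fp p)
  else nderiv u f (g \o q).

Lemma spline_int_scaleS n a f g : nice f -> spline_int n (scaleS a f) g = a * spline_int n f g.
Proof.
elim: n f g => [|n IH] f g nf /=; first exact: harm_int_scaleS.
rewrite mulr_sumr; apply: eq_bigr => p _.
rewrite -[pull p (scaleS a f)]/(scaleS a (pull p f)) IH; first ring.
exact: nice_pull.
Qed.

Lemma Phi_split n u f g : nice f -> Phi n u f g = spline_energy n u g + spline_int n f g.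
Proof.
elim: n u f g => [|n IH] u f g nf //=.
rewrite -big_split /=; apply: eq_bigr => p _.
have nf' := nice_pull p nf.
rewrite IH ?spline_int_scaleS //; last exact: nice_scaleS.
rewrite mulrDr; congr (_ + _); rewrite -(resf_muf r_gt0 p) !mulrA mulVf ?mul1r //.
by rewrite lt0r_neq0 // resf_gt0.
Qed.

(** From level [n] on the spline is harmonic on each cell, so the graph energies no longer change.
    The energy of the spline with any function is therefore a limit of an eventually constant
    sequence. *)
Lemma word_energy_spline n m u g : (n <= m)%N -> compat u -> word_energy m u (sampling (spline n g)) = spline_energy n u g.
Proof.
elim: n m u g => [|n IH] m u g nm cu.
  by rewrite [spline 0 g]/= sampling_harm_ext // word_energy_harm.
case: m nm => // m nm /=; apply: eq_bigr => p _.
rewrite -[glue _ _ _]/(spline n.+1 g) sampling_spline // IH //; exact: compat_pull.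
Qed.

Lemma spline_int_cvg n f g : nice f ->
  (fun m => riemann_sum m (mulS (sampling (spline n g)) f)) @ \oo --> spline_int n f g.
Proof.
elim: n f g => [|n IH] f g nf.
  by rewrite [spline 0 g]/= sampling_harm_ext //=; exact: harm_int_cvg.
rewrite -cvg_shiftS /=; apply: cvgn_sum => p; apply: cvgMr.
rewrite (_ : (fun m => _) = fun m => riemann_sum m (mulS (sampling (spline n (g \o Fp p))) (pull p f))).
  by apply: IH; exact: nice_pull.
by apply/funext => m; congr (riemann_sum m _); rewrite -(sampling_spline triq gasketSG r_gt0).
Qed.

Lemma Fw_rcons w p x : Fw (rcons w p) x = Fw w (Fp p x).
Proof. by rewrite -cats1 Fw_cat. Qed.

Lemma sampling_compat g : compat (sampling g).
Proof.
split=> [w x|w i]; rewrite /sampling !Fw_rcons; first by rewrite Fp_mate.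
by rewrite Fp_q.
Qed.

Lemma sampling_nice g : cellwise_uc g -> nice (sampling g).
Proof.
move=> ug; split.
- have [C C0 HC] := cellwise_uc_bounded triq gasketSG ug; exists C => w k.
  by apply: HC; apply: (SG_Fw gasketSG w (SGq k)).
- move=> e e0; have [m H] := ug e e0; exists m => w w' k k' mu_word.
  by rewrite /sampling Fw_cat; apply: H => //; [exact: (SG_Fw gasketSG w' (SGq k))|exact: SGq].
- move=> w c; have ul : cellwise_uc (fun x => harm_ext c x * (g \o Fw w) x).
    by apply: (cellwise_uc_mul triq gasketSG); [exact: cellwise_uc_harm_ext|exact: cellwise_uc_comp_Fw].
  have := Rintegral_riemann_sum triq gasketSG r_gt0 ssmu ul.
  rewrite (_ : (fun m => _) = fun m => riemann_sum m (mulS (harm c) (pullw w (sampling g)))).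
    by move=> h; apply/cvg_ex; eexists; exact: h.
  apply/funext => m; congr (riemann_sum m _); rewrite -(sampling_harm_ext triq gasketSG r_gt0).
  by apply: sampleP => w' i; rewrite /mulS /pullw /sampling /= Fw_cat.
Qed.

Lemma has_laplacian_Phi (u f : plane R -> R) n g : has_laplacian q SG r mu u f ->
  (forall i, g (q i) = 0) -> Phi n (sampling u) (sampling f) g = 0.
Proof.
move=> [du cf H] g0; have uf := within_cellwise_uc gasketSG cf.
have nf := sampling_nice uf.
have us : cellwise_uc (spline n g) by exact: cellwise_uc_spline.
have En_cvg (v : plane R -> R) :
    (fun m => graph_energy q r m v (spline n g)) @ \oo --> spline_energy n (sampling v) g.
  apply: cvg_near_cst; near=> m; rewrite graph_energyE word_energy_spline //; last exact: sampling_compat.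
  by near: m; exists n.
have ds : dom_energy q SG r (spline n g).
  split; first exact: (cellwise_uc_within gasketSG us).
  by apply/cvg_ex; eexists; exact: En_cvg.
have s0 i : spline n g (q i) = 0 by rewrite spline_q.
have := H _ ds s0; rewrite /energy (cvg_lim _ (En_cvg u)) //.
have usf : cellwise_uc (fun x => spline n g x * f x) by exact: (cellwise_uc_mul triq gasketSG).
have -> : (\int[mu]_(x in SG) (spline n g x * f x)%:E)%E =
    (\int[mu]_(x in SG) (spline n g x * f x))%R%:E.
  have mSG : measurable (SG : set (borel_plane R)).
    exact: borel_closed (SG_closed gasketSG).
  by rewrite /Rintegral fineK // integrable_fin_num //; exact: (cellwise_uc_integrable mu triq gasketSG usf).
move=> [e]; rewrite Phi_split //.
have := lim_uniq (Rintegral_riemann_sum triq gasketSG r_gt0 ssmu usf) (@spline_int_cvg n _ g nf).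
by rewrite -e => <-; rewrite subrr.
Unshelve. all: by end_near. Qed.

(** Only the values of [g] at the vertices of level [n] enter, so [g] may be the indicator of a
    point or an extension by zero. *)
Definition weakS (u f : sample R) : Prop :=
  forall n g, (forall i, g (q i) = 0) -> Phi n u f g = 0.

Lemma Phi_ext n u f g g' : (forall x, SG x -> g x = g' x) -> Phi n u f g = Phi n u f g'.
Proof.
elim: n u f g g' => [|n IH] u f g g' gg' /=.
  by congr (nderiv _ _ _); apply/funext => i; apply: gg'; exact: SGq.
apply: eq_bigr => p _; congr (_ * _); apply: IH => x Sx; apply: gg'.
exact: SG_Fp.
Qed.

Lemma Phi_0 n u f : Phi n u f (fun=> 0) = 0.
Proof.
elim: n u f => [|n IH] u f /=.
  rewrite nderivE (_ : _ \o q = fun=> 0) // Jc0 // addr0.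
  by apply: big1 => i _; rewrite mul0r.
by apply: big1 => p _; rewrite IH mulr0.
Qed.

(** Localisation: a test function on the cell [p] is extended by zero to the other cells. They meet
    [p] only at its corners, where the test function vanishes. *)
Lemma weakS_pull p u f : weakS u f -> weakS (pull p u) (scaleS L (pull p f)).
Proof.
move=> H n g g0.
pose gt x := if `[< SG (Finv p x) >] then g (Finv p x) else 0.
have gtp y : SG y -> gt (Fp p y) = g y.
  by move=> Sy; rewrite /gt FpK asboolT.
have b0 y (Sy : SG y) i := SG_bary_ge0 triq gasketSG i Sy.
have gtp' p' y : p != p' -> SG y -> gt (Fp p' y) = 0.
  move=> pp' Sy; rewrite /gt; case: asboolP => // Sz.
  have e : Fp p (Finv p (Fp p' y)) = Fp p' y by rewrite FinvK.
  by have [i [-> _ _ _]] := Fp_junction triq (b0 _ Sz) (b0 _ Sy) e pp'; rewrite g0.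
have gtq i : gt (q i) = 0.
  rewrite -(Fp_q triq i); have [pe|pi] := eqVneq p (i, i); last by rewrite gtp' //; exact: SGq.
  by rewrite /gt pe FpK asboolT ?g0 //; exact: SGq.
have := H n.+1 gt gtq; rewrite /= (bigD1 p) //= big1 ?addr0 => [|p' pp'].
  move/eqP; rewrite mulf_eq0 invr_eq0 (gt_eqF (resf_gt0 r_gt0 p)) /= => /eqP <-.
  by apply: Phi_ext => x Sx /=; rewrite gtp.
rewrite (@Phi_ext _ _ _ _ (fun=> 0)) ?Phi_0 ?mulr0 // => x Sx /=.
by rewrite gtp' // eq_sym.
Qed.

Lemma q_inj : injective q.
Proof.
move=> i j e; have := congr1 (bary q i) e; rewrite !bary_q // eqxx.
by case: eqP => // _ /eqP; rewrite oner_eq0.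
Qed.

Lemma Fp_eq (x y : cell * 'I_3) : Fp x.1 (q x.2) = Fp y.1 (q y.2) -> y = x \/ y = mate x.
Proof.
case: x y => [p i] [p' i'] /= e; have [pp|pp] := eqVneq p p'.
  left; rewrite -pp in e *; congr (_, _); apply: q_inj.
  by rewrite -(FpK q p (q i')) -e FpK.
have b0 k i := SG_bary_ge0 triq gasketSG i (SGq k).
have [k [/q_inj <- p'E /q_inj i'E _]] := Fp_junction triq (b0 i) (b0 i') e pp.
by right; rewrite [RHS]surjective_pairing -p'E -i'E.
Qed.

Lemma mate_neq (x : cell * 'I_3) : ~~ corner x -> mate x != x.
Proof.
case: x => [[a b] i]; rewrite /mate /corner /=.
have [->|bi] := eqVneq b i; last by rewrite !xpair_eqE (negbTE bi) !andbF.
by rewrite andbT !xpair_eqE => /negbTE ->; rewrite !andbF.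
Qed.

(** The test function is the indicator of the junction point. Exactly two pairs, [x] and [mate x],
    are addresses of that point, so the weak equation reduces to the sum of the two fluxes. *)
Lemma weakS_junct u f : nice f -> weakS u f -> junct r u f.
Proof.
move=> nf H x nx; pose g z : R := (z == Fp x.1 (q x.2))%:R.
have gq i : g (q i) = 0.
  rewrite /g; case: eqP => // e.
  have := @Fp_eq ((i, i), i) x; rewrite /= (Fp_q triq) => /(_ e).
  have ci : corner ((i, i), i) by rewrite /corner /= eqxx.
  by move=> [|] xE; move: nx; rewrite xE ?corner_mate ci.
have gE (y : cell * 'I_3) : g (Fp y.1 (q y.2)) = ((y == x) || (y == mate x))%:R.
  rewrite /g; congr (_%:R); congr nat_of_bool; apply/eqP/orP.
    by move=> /esym/Fp_eq[->|->]; rewrite eqxx; [left|right].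
  by move=> [/eqP ->//|/eqP ->]; exact: Fp_mate.
have := H 1%N g gq; rewrite /=.
have -> : \sum_p (resf p)^-1 * nderiv (pull p u) (scaleS L (pull p f)) ((g \o Fp p) \o q) =
    \sum_(y : cell * 'I_3) g (Fp y.1 (q y.2)) * flux r u f y.
  rewrite sum_pair; apply: eq_bigr => p _.
  rewrite nderiv_sum //; last by apply: nice_scaleS => //; exact: nice_pull.
  by rewrite mulr_sumr; apply: eq_bigr => i _; rewrite /flux /=; ring.
rewrite (bigD1 x) //= gE eqxx mul1r (bigD1 (mate x)) ?mate_neq //=.
rewrite gE eqxx orbT mul1r big1 ?addr0 // => y /andP[/negbTE y1 /negbTE y2].
by rewrite gE y1 y2 mul0r.
Qed.

Lemma weakS_islap u f : compat u -> nice f -> weakS u f -> islap r u f.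
Proof.
move=> cu nf uf; split => // w.
suff [] : nice (scaleS (L ^+ size w) (pullw w f)) /\
    weakS (pullw w u) (scaleS (L ^+ size w) (pullw w f)) by exact: weakS_junct.
elim: w u f {cu} nf uf => [|p w IH] u f nf uf; first by rewrite expr0 scl1.
have nf' : nice (scaleS L (pull p f)) by apply: nice_scaleS => //; exact: nice_pull.
have [h1 h2] := IH _ _ nf' (weakS_pull p uf).
have E : scaleS (L ^+ size (p :: w)) (pullw (p :: w) f) =
    scaleS (L ^+ size w) (pullw w (scaleS L (pull p f))).
  by rewrite /= exprSr -sclA.
by rewrite E.
Qed.

Lemma has_laplacian_islap (u f : plane R -> R) :
  has_laplacian q SG r mu u f -> islap r (sampling u) (sampling f).
Proof.
move=> H; have [_ cf _] := H; apply: weakS_islap; first exact: sampling_compat.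
  exact: sampling_nice (within_cellwise_uc gasketSG cf).
by move=> n g; exact: has_laplacian_Phi.
Qed.

End WeakLaplacian.

(** * From monomials on the gasket to towers of samples *)

Section Assembly.
Variables (R : realType) (q : 'I_3 -> plane R) (SG : set (plane R)) (r : R).
Variable mu : probability (borel_plane R) R.
Hypothesis triq : is_triangle q.
Hypothesis gasketSG : is_gasket q SG.
Hypothesis r_gt0 : 0 < r.
Hypothesis ssmu : is_selfsimilar_measure q SG r mu.
Local Notation sampling := (sampling q).
Local Notation c0 := ((o0, o0) : cell).

Lemma Fword_nseq m (x : plane R) : Fword q (nseq m c0) x = iter m (F q o0 o0) x.
Proof. by elim: m => //= m ->. Qed.

Lemma monomial_monom j k (P : plane R -> R) : is_monomial q SG r mu j k P ->
  exists2 Dl : nat -> plane R -> R, Dl 0%N = P & monom r j k (fun l => sampling (Dl l)).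
Proof.
move=> [Dl [[D0 lapD] [n Dn] dD]]; exists Dl => //.
have hD l : islap r (sampling (Dl l)) (sampling (Dl l.+1)).
  exact: has_laplacian_islap triq gasketSG r_gt0 ssmu _ _ (lapD l).
have o01 : (0 + 1 : 'I_3) = o1 by exact: val_inj.
have o02 : (0 - 1 : 'I_3) = o2 by exact: val_inj.
have fix0 m : Fword q (nseq m c0) (q o0) = q o0.
  by elim: m => //= m ->; exact: (Fp_q triq o0).
split; first split => //.
  (* The definition of a monomial gives the vanishing at level [n.+1] only; from there
     [islap_zero_uniq] carries it upwards. *)
  exists n.+1 => l nl; rewrite -(subnK nl); elim: (l - n.+1)%N => [|i IH].
    apply: sampleP => w i; rewrite /sampling Dn //.
    exact: (SG_Fw gasketSG w (SG_q triq gasketSG i)).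
  have := hD (i + n.+1)%N; rewrite IH => /islap_zero_uniq; apply => //.
  exact: sampling_compat.
move=> l; have [x1 y1 t1] := dD l; rewrite ord3_0 in x1; split.
- by rewrite -x1.
- apply: lim_uniq (normal_lim r_gt0 (hD l)) _; move: y1; rewrite /has_normal_deriv o01 o02 ord3_0.
  set u1 := (fun m => _); set u2 := (fun m => _).
  rewrite (_ : u1 = u2) //; apply/funext => m; rewrite /u1 /u2 /lap sum3 /sampling !fix0 !Fword_nseq.
  by rewrite -[lambda_sym r]/(res0 r); ring.
- move: t1; rewrite /has_tangential_deriv o01 o02 ord3_0.
  set u1 := (fun m => _); rewrite (_ : u1 = tang_seq r (sampling (Dl l))) //.
  by apply/funext => m; rewrite /u1 /tang_seq /sampling !Fword_nseq.
Qed.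

End Assembly.

(** Both points lie on the axis of the reflection, since it exchanges their two addresses, and an
    odd function vanishes there. *)
Lemma monom3_axis (R : realType) (r : R) (r_gt0 : 0 < r) j U : monom r j 3 U ->
  U 0%N [:: (o0, o1)] o2 = 0 /\ U 0%N [:: (o1, o2)] o2 = 0.
Proof.
move=> mU; have [[hU _] _] := mU; have [[c1 _] _ _] := hU 0%N.
have E := monom_flip r_gt0 mU isT.
have F w i : U 0%N (map (perm_cell flip) w) (flip i) = - U 0%N w i.
  by have := congr1 (fun f : sample R => f w i) E; rewrite /permS /scaleS /= mulN1r.
have e1 := F [:: (o0, o1)] o2; have e2 := F [:: (o1, o2)] o2.
have m1 := c1 [::] ((o0, o1), o2); have m2 := c1 [::] ((o1, o2), o2).
rewrite /= in e1 e2 m1 m2.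
rewrite -[perm_cell _ _]/(o0, o2) in e1; rewrite m1 in e1; rewrite m2 in e2; split; lra.
Qed.

Unset Implicit Arguments.
Set Strict Implicit.

Theorem theorem2p7 (R : realType) (q : 'I_3 -> plane R) (SG : set (plane R))
    (r : R) (mu : probability (borel_plane R) R)
    (P : nat -> nat -> plane R -> R) :
  is_triangle q ->
  is_gasket q SG ->
  0 < r ->
  is_selfsimilar_measure q SG r mu ->
  (forall j k : nat, (1 <= k <= 3)%N -> is_monomial q SG r mu j k (P j k)) ->
  let D := Dpar r in
  let L := Lpar r in
  let lsym := lambda_sym r in
  let lskew := lambda_skew r in
  let alpha (j : nat) := P j 1%N (q 1) in
  let beta (j : nat) := P j 2%N (q 1) in
  let gamma (j : nat) := P j 3%N (q 1) in
  let a (j k : nat) := P j k (F q 0 1 (q 1)) in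
  let b (j k : nat) := P j k (F q 0 1 (q 2)) in
  let c (j k : nat) := P j k (F q 1 1 (q 0)) in
  let d (j k : nat) := P j k (F q 1 0 (q 2)) in
  let e (j k : nat) := P j k (F q 1 1 (q 2)) in
  let f (j k : nat) := P j k (F q 1 2 (q 2)) in
  (forall j : nat,
     lsym * L ^+ j * beta j + r * a j 2%N + r * b j 2%N
       = (2 + 2 * r) *
         (\sum_(0 <= i < j.+1) lsym * L ^+ j * alpha i * beta (j - i)%N) /\
     lsym * L ^+ j * beta j + b j 2%N + c j 2%N + d j 2%N
       = 4 * (\sum_(0 <= i < j.+1) L ^+ i * alpha i * a (j - i)%N 2%N) /\
     2 * lsym * L ^+ j * beta j + 2 * a j 2%N
       = 4 * (\sum_(0 <= i < j.+1) L ^+ i * alpha i * b (j - i)%N 2%N) /\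
     beta j + r * a j 2%N + r * d j 2%N + e j 2%N
       = (2 + 2 * r) *
         (\sum_(0 <= i < j.+1) L ^+ i * alpha i * c (j - i)%N 2%N) /\
     a j 2%N + c j 2%N + e j 2%N + f j 2%N
       = 4 * (\sum_(0 <= i < j.+1) L ^+ i * alpha i * d (j - i)%N 2%N) /\
     beta j + c j 2%N + r * d j 2%N + r * f j 2%N
       = (2 + 2 * r) *
         (\sum_(0 <= i < j.+1) L ^+ i * alpha i * e (j - i)%N 2%N) /\
     2 * d j 2%N + 2 * e j 2%N
       = 4 * (\sum_(0 <= i < j.+1) L ^+ i * alpha i * f (j - i)%N 2%N)) /\
  (beta 0%N = - (1 / 2) /\
   a 0%N 2%N = - ((3 * r ^+ 2 + 8 * r + 4) / D) /\
   b 0%N 2%N = - ((3 * r ^+ 2 + 7 * r + 2) / D) /\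
   c 0%N 2%N = - ((6 * r ^+ 2 + 19 * r + 15) / (2 * D)) /\
   d 0%N 2%N = - ((6 * r ^+ 2 + 19 * r + 13) / (2 * D)) /\
   e 0%N 2%N = - ((6 * r ^+ 2 + 21 * r + 15) / (2 * D)) /\
   f 0%N 2%N = - ((3 * r ^+ 2 + 10 * r + 7) / D)) /\
  (forall j : nat,
     - lskew * L ^+ j * gamma j + r * a j 3%N
       = (2 + 2 * r) *
         (\sum_(0 <= i < j.+1) lskew * L ^+ j * alpha i * gamma (j - i)%N) /\
     lskew * L ^+ j * gamma j + c j 3%N + d j 3%N
       = 4 * (\sum_(0 <= i < j.+1) L ^+ i * alpha i * a (j - i)%N 3%N) /\
     gamma j + r * a j 3%N + r * d j 3%N + e j 3%N
       = (2 + 2 * r) *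
         (\sum_(0 <= i < j.+1) L ^+ i * alpha i * c (j - i)%N 3%N) /\
     a j 3%N + c j 3%N + e j 3%N
       = 4 * (\sum_(0 <= i < j.+1) L ^+ i * alpha i * d (j - i)%N 3%N) /\
     gamma j + c j 3%N + r * d j 3%N
       = (2 + 2 * r) *
         (\sum_(0 <= i < j.+1) L ^+ i * alpha i * e (j - i)%N 3%N)) /\
  (gamma 0%N = 1 / 2 /\
   a 0%N 3%N = (2 * r + 3) / D /\
   c 0%N 3%N = (9 * r + 15) / (2 * D) /\
   d 0%N 3%N = (5 * r + 9) / (2 * D) /\
   e 0%N 3%N = (7 * r + 15) / (2 * D)).
Proof.
move=> triq gasketSG r_gt0 ssmu Hmon D L lsym lskew alpha beta gamma a b c d e f.
have /choice[DD HD] : forall jk : nat * nat, exists Dl : nat -> plane R -> R,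
    (1 <= jk.2 <= 3)%N -> Dl 0%N = P jk.1 jk.2 /\
    monom r jk.1 jk.2 (fun l => sampling q (Dl l)).
  move=> [j k] /=; have [k3|_] := boolP (1 <= k <= 3)%N; last by exists (fun _ _ => 0).
  by have [Dl D0 Dm] := monomial_monom triq gasketSG r_gt0 ssmu (Hmon j k k3); exists Dl.
(* Level 0 is defined through [P] itself, so that the values in the system are values of [P j k] by
   computation. *)
pose M j k l := if l is 0%N then sampling q (P j k) else sampling q (DD (j, k) l).
have mM j k : (1 <= k <= 3)%N -> monom r j k (M j k).
  move=> k3; have [/= D0 Dm] := HD (j, k) k3.
  by rewrite (_ : M j k = fun l => sampling q (DD (j, k) l)) //; apply/funext => -[|l] //=; rewrite D0.
rewrite /alpha /beta /gamma /a /b /c /d /e /f ord3_2 ord3_1 ord3_0.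
split; [|split; [|split]].
- move=> j; have [[s1 s2 s3 s4] [s5 s6 s7]] := monom_system r_gt0 mM (isT : (2 <= 2 <= 3)%N) j.
  rewrite /= /M /sampling /= in s1 s2 s3 s4 s5 s6 s7.
  do ![split]; [apply: etrans _ s1|apply: etrans _ s2|apply: etrans _ s3|apply: etrans _ s4
    |apply: etrans _ s5|apply: etrans _ s6|apply: etrans _ s7]; rewrite /lsym /lambda_sym /L; ring.
- have [[i1 i2 i3] [i4 i5 i6]] := monom0_init2 r_gt0 (mM 0%N 2 isT).
  by have := monom0_q1 r_gt0 (mM 0%N 2 isT) isT.
- move=> j; have [[s1 s2 s3 s4] [s5 s6 s7]] := monom_system r_gt0 mM (isT : (2 <= 3 <= 3)%N) j.
  have [b0 f0] := monom3_axis r_gt0 (mM j 3 isT).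
  rewrite /= /M /sampling /= in s1 s2 s3 s4 s5 s6 s7 b0 f0.
  rewrite b0 f0 in s1 s2 s3 s4 s5 s6 s7.
  (* The equations [s3] and [s7] at the axis points are left out: their left sides carry the factor
     [1 + e], which is 0 for odd monomials. *)
  do ![split]; [apply: etrans _ s1|apply: etrans _ s2|apply: etrans _ s4
    |apply: etrans _ s5|apply: etrans _ s6]; rewrite /lskew /L; ring.
- have [i1 i2 i3 i4] := monom0_init3 r_gt0 (mM 0%N 3 isT).
  by have := monom0_q1 r_gt0 (mM 0%N 3 isT) isT.
Qed.
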